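(* Let $1\le p<\infty$ and let $w$ be a quasi-concave function on $[0,1]$ with $w(1)=1$ and $\lim_{t\to0^+}w(t)=0$. Let $\mathcal R_p$ be the closed linear span of the Rademacher functions $\{r_n\}_{n=1}^\infty$ in the Morrey space $M_{p,w}$. Then every infinite-dimensional closed linear subspace $X$ of $\mathcal R_p$ is either isomorphic to $l_2$, or contains a closed subspace which is isomorphic to $c_0$ and is complemented in $\mathcal R_p$.
   Context: A function $w:[0,1]\to[0,\infty)$ is quasi-concave if $w(0)=0$, $w$ is non-decreasing, and $w(t)/t$ is non-increasing on $(0,1]$. The Morrey space $M_{p,w}$ is the Banach space of all (a.e. classes of) measurable $f:[0,1]\to\mathbb R$ with $$\|f\|_{M_{p,w}}=\sup_I w(|I|)\Big(\frac1{|I|}\int_I|f(t)|^p\,dt\Big)^{1/p}<\infty,$$ the supremum being over all (non-degenerate) intervals $I\subset[0,1]$, where $|I|$ is the Lebesgue measure of $I$. The Rademacher functions are $r_k(t)=\mathrm{sign}(\sin 2^k\pi t)$, $k\in\mathbb N=\{1,2,\dots\}$, $t\in[0,1]$. ''Isomorphic'' means linearly homeomorphic. A closed subspace is complemented in a Banach space if it is the range of a bounded linear projection of that space. *)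

(* Defs.v *)
From HB Require Import structures.
From mathcomp Require Import all_boot all_order all_algebra.
From mathcomp Require Import all_classical all_reals all_analysis.
From mathcomp Require Import measurable_realfun.

Set Implicit Arguments.
Unset Strict Implicit.
Unset Printing Implicit Defensive.

Import Order.TTheory GRing.Theory Num.Theory.
Import numFieldNormedType.Exports.

Local Open Scope classical_set_scope.
Local Open Scope ring_scope.

Section linear_subspaces.
Context (R : realType) (E : normedModType R).
Implicit Types (S X Y Z : set E).

Definition linear_subspace (X : set E) : Prop := submod_closed (mem X).

Definition lin_span S : set E :=
  [set x | exists (n : nat) (a : 'I_n -> R) (v : 'I_n -> E),
     (forall i, S (v i)) /\ x = \sum_(i < n) a i *: v i].

Definition closed_span S : set E := closure (lin_span S).

Definition finite_dimensional X : Prop :=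
  exists2 S, finite_set S & X = lin_span S.

(* T is a linear homeomorphism of F onto X, with inverse S. *)
Definition isomorphic (X : set E) (F : normedModType R) : Prop :=
  exists (T : {linear F -> E}) (S : E -> F),
    [/\ continuous T, range T = X, cancel T S & {within X, continuous S}].

(* P is a bounded linear projection of Z onto Y; its values outside Z are     *)
(* irrelevant.                                                                *)
Definition complemented_in (Y Z : set E) : Prop :=
  Y `<=` Z /\
  exists P : E -> E,
    [/\ forall (a : R) x y, Z x -> Z y -> P (a *: x + y) = a *: P x + P y,
        exists C : R, forall x, Z x -> `|P x| <= C * `|x|,
        forall x, Z x -> P (P x) = P x
      & P @` Z = Y].

End linear_subspaces.

Section l2.
Context (R : realType).

(* Square-summable real sequences, as L^2 of the counting measure; no quotient *)
(* is needed since only the empty set is negligible.                          *)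
Definition l2 : Type := LfunType (@counting nat R) (lee1n 2 : (1 <= 2%:E)%E).

HB.instance Definition _ := GRing.Lmodule.on l2.

Definition l2_norm (x : l2) : R := fine ('N[counting]_2%:E[EFin \o x])%E.

Lemma l2_normD (x y : l2) : l2_norm (x + y) <= l2_norm x + l2_norm y.
Proof. exact: ler_LnormD. Qed.

Lemma l2_normZ (a : R) (x : l2) : l2_norm (a *: x) = `|a| * l2_norm x.
Proof.
apply: EFin_inj; rewrite EFinM /l2_norm !finite_norm_fine.
exact: (LnormZ x a).
Qed.

Lemma l2_norm0_eq0 (x : l2) : l2_norm x = 0 -> x = 0.
Proof.
move=> nx0; have x0 : ('N[counting]_2%:E[EFin \o x])%E = 0%E.
  by rewrite -finite_norm_fine -[X in X%:E]/(l2_norm x) nx0.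
rewrite Lnorm_counting// in x0.
have x2_ge0 i : (0 <= `|(x i)%:E| `^ 2)%E by exact: poweR_ge0.
have h : (\sum_(k <oo) `|(x k)%:E| `^ 2 = 0)%E.
  by apply: (poweR_eq0_eq0 _ x0); apply: nneseries_ge0 => i _ _; exact: x2_ge0.
apply/val_inj/funext => k /=.
have xk0 : (`|(x k)%:E| `^ 2 = 0)%E.
  apply/eqP; rewrite eq_le x2_ge0 andbT -h (@nneseriesD1 _ _ k)//.
  by rewrite leeDl// nneseries_ge0.
have := poweR_eq0_eq0 (abse_ge0 _) xk0.
by move=> [] /normr0_eq0.
Qed.

HB.instance Definition _ :=
  Lmodule_isNormed.Build R l2 l2_normD l2_normZ l2_norm0_eq0.
End l2.

Section c0.
Context (R : realType).

Definition c0_pred : {pred (nat -> R)} := [pred x : nat -> R | `[< x @ \oo --> (0 : R) >]].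

Lemma c0_submod_closed : submod_closed c0_pred.
Proof.
split; first by apply/asboolP; exact: cvg_cst.
move=> a x y /asboolP cx /asboolP cy; apply/asboolP.
have -> : (0 : R) = a * 0 + 0 by rewrite mulr0 addr0.
by apply: cvgD => //; exact: cvgMl_tmp.
Qed.

HB.instance Definition _ := GRing.isSubmodClosed.Build R (nat -> R) c0_pred
  c0_submod_closed.

Record c0 := C0 { c0_val :> nat -> R ; _ : c0_val \in c0_pred }.

HB.instance Definition _ := [isSub for c0_val].
HB.instance Definition _ := [Choice of c0 by <:].
HB.instance Definition _ := [SubChoice_isSubLmodule of c0 by <:].

Definition c0_norm (x : c0) : R := sup (range (fun n => `|x n|)).

Lemma c0_has_sup (x : c0) : has_sup (range (fun n => `|x n|)).
Proof.
split; first by exists `|x 0%N|, 0%N.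
have /asboolP cx := valP x.
have [M [_ bM]] := cvg_seq_bounded (cvgP _ cx : cvgn (x : nat -> R)).
by exists (M + 1) => _ [n _ <-]; apply: bM => //; rewrite ltrDl.
Qed.

Lemma c0_norm_ub (x : c0) n : `|x n| <= c0_norm x.
Proof. by apply: ub_le_sup; [have [] := c0_has_sup x|exists n]. Qed.

Lemma c0_norm_le (x : c0) M : (forall n, `|x n| <= M) -> c0_norm x <= M.
Proof.
by move=> xM; apply: ge_sup; [have [] := c0_has_sup x|move=> _ [n _ <-]].
Qed.

Lemma c0_normD (x y : c0) : c0_norm (x + y) <= c0_norm x + c0_norm y.
Proof.
apply: c0_norm_le => n; apply: (le_trans (ler_normD _ _)).
by apply: lerD; exact: c0_norm_ub.
Qed.

Lemma c0_normZ (a : R) (x : c0) : c0_norm (a *: x) = `|a| * c0_norm x.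
Proof.
apply/eqP; rewrite eq_le; apply/andP; split.
  apply: c0_norm_le => n.
  by rewrite [leLHS]normrM; apply: ler_wpM2l => //; exact: c0_norm_ub.
have [->|a0] := eqVneq a 0.
  by rewrite normr0 mul0r (le_trans _ (c0_norm_ub _ 0%N)).
rewrite mulrC -ler_pdivlMr ?normr_gt0//; apply: c0_norm_le => n.
rewrite ler_pdivlMr ?normr_gt0// mulrC -normrM.
exact: (c0_norm_ub (a *: x)).
Qed.

Lemma c0_norm0_eq0 (x : c0) : c0_norm x = 0 -> x = 0.
Proof.
move=> x0; apply/val_inj/funext => n /=; apply/eqP.
by rewrite -normr_le0 -x0 c0_norm_ub.
Qed.

HB.instance Definition _ :=
  Lmodule_isNormed.Build R c0 c0_normD c0_normZ c0_norm0_eq0.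
End c0.

Record quasi_concave (R : realType) (w : R -> R) : Prop := {
  quasi_concave_ge0 : forall t, 0 <= t <= 1 -> 0 <= w t;
  quasi_concave0 : w 0 = 0;
  quasi_concave_nondecreasing :
    forall s t, 0 <= s -> s <= t -> t <= 1 -> w s <= w t;
  quasi_concave_nonincreasing :
    forall s t, 0 < s -> s <= t -> t <= 1 -> w t / t <= w s / s }.

Section morrey_enorm.
Context (R : realType).
Local Open Scope ereal_scope.
Local Notation mu := (@lebesgue_measure R).

Definition subintervals : set (set R) :=
  [set I | [/\ is_interval I, I `<=` `[0%R, 1%R] & 0 < mu I]].

Definition morrey_term (p : R) (w f : R -> R) (I : set R) : \bar R :=
  (w (fine (mu I)))%:E *
  ((fine (mu I))^-1%:E * \int[mu]_(t in I) (`|f t| `^ p)%:E) `^ p^-1.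

End morrey_enorm.

HB.lock Definition morrey_enorm (R : realType) (p : R) (w f : R -> R) : \bar R :=
  ereal_sup [set morrey_term p w f I | I in @subintervals R].
Canonical morrey_enorm_unlockable := Unlockable morrey_enorm.unlock.

Section morrey_theory.
Context (R : realType) (p : R) (w : R -> R).
Context (p1 : 1 <= p) (qw : quasi_concave w) (w1 : w 1 = 1).
Local Notation mu := (@lebesgue_measure R).
Local Notation U := (`[0 : R, 1]%classic).
Local Notation term := (morrey_term p w).
Local Notation N := (morrey_enorm p w).
Implicit Types (f g : R -> R) (I : set R).

Let p_gt0 : 0 < p. Proof. exact: lt_le_trans p1. Qed.

Let muU : mu U = 1%E.
Proof. by rewrite lebesgue_measure_itv/= lte_fin ltr01 oppr0 adde0. Qed.

Let subU : subintervals U.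
Proof. by split => //; [exact: interval_is_interval|rewrite muU lte01]. Qed.

Let measI I : subintervals I -> measurable I.
Proof. by move=> [iI _ _]; exact: is_interval_measurable. Qed.

Let muI_le1 I : subintervals I -> (mu I <= 1)%E.
Proof.
by move=> sI; rewrite -muU le_measure ?inE//; [exact: measI|case: sI].
Qed.

Let muI_fin I : subintervals I -> mu I \is a fin_num.
Proof.
move=> sI; rewrite ge0_fin_numE//; apply: (le_lt_trans (muI_le1 sI)).
exact: ltry.
Qed.

Let len_gt0 I : subintervals I -> 0 < fine (mu I).
Proof. by move=> sI; rewrite -lte_fin fineK ?muI_fin//; case: sI. Qed.

Let len_le1 I : subintervals I -> fine (mu I) <= 1.
Proof. by move=> sI; rewrite -lee_fin fineK ?muI_fin// muI_le1. Qed.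

Let w_ge0 I : subintervals I -> 0 <= w (fine (mu I)).
Proof.
by move=> sI; apply: (quasi_concave_ge0 qw); rewrite len_le1// ltW// len_gt0.
Qed.

Let w_le1 I : subintervals I -> w (fine (mu I)) <= 1.
Proof.
move=> sI; rewrite -w1; apply: (quasi_concave_nondecreasing qw) => //.
  by rewrite ltW// len_gt0.
exact: len_le1.
Qed.

Let term_le f I : subintervals I -> (term f I <= N f)%E.
Proof. by move=> sI; rewrite unlock; apply: ereal_sup_ubound; exists I. Qed.

Let N_le f M : (forall I, subintervals I -> (term f I <= M)%E) -> (N f <= M)%E.
Proof. by move=> fM; rewrite unlock; apply: ge_ereal_sup => _ [I sI <-]; exact: fM. Qed.

Let Lp f I := 'N[mu]_p%:E[EFin \o (f \_ I)]%E.

Let coef I := w (fine (mu I)) * (fine (mu I))^-1 `^ p^-1.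

Let coef_ge0 I : subintervals I -> 0 <= coef I.
Proof. by move=> sI; rewrite mulr_ge0 ?w_ge0// powR_ge0. Qed.

Let int_ge0 f I : (0 <= \int[mu]_(t in I) (`|f t| `^ p)%:E)%E.
Proof. by apply: integral_ge0 => t _; rewrite lee_fin powR_ge0. Qed.

Let LpE f I :
  (Lp f I = (\int[mu]_(t in I) (`|f t| `^ p)%:E) `^ p^-1)%E.
Proof.
rewrite /Lp Lnorm.unlock; apply: (congr1 (fun x => x `^ p^-1)%E).
rewrite [RHS]integral_mkcond; apply: eq_integral => t _ /=.
rewrite !patchE; case: ifPn => // _.
by rewrite normr0 powR0// gt_eqF.
Qed.

Let termE f I : subintervals I -> (term f I = (coef I)%:E * Lp f I)%E.
Proof.
move=> sI; rewrite LpE /morrey_term /coef poweRM//; last first.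
  by rewrite lee_fin invr_ge0 ltW// len_gt0.
by rewrite poweR_EFin muleA -EFinM.
Qed.

Let term_ge0 f I : subintervals I -> (0 <= term f I)%E.
Proof. by move=> sI; rewrite termE// mule_ge0 ?lee_fin ?coef_ge0// Lnorm_ge0. Qed.

Lemma morrey_enorm_ge0 f : (0 <= N f)%E.
Proof.
exact: le_trans (term_ge0 f subU) (term_le f subU).
Qed.

Let measfI f I : measurable_fun U f -> subintervals I ->
  measurable_fun [set: R] (f \_ I).
Proof.
move=> mf sI; apply: (iffLR (measurable_restrictT _ (measI sI))).
by case: (sI) => _ IU _; apply: measurable_funS mf.
Qed.

Lemma morrey_enormD f g : measurable_fun U f -> measurable_fun U g ->
  (N (f + g)%R <= N f + N g)%E.
Proof.
move=> mf mg; apply: N_le => I sI.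
apply: (@le_trans _ _ (term f I + term g I)%E); last first.
  by apply: leeD; exact: term_le.
rewrite !termE// -ge0_muleDr ?Lnorm_ge0//.
apply: lee_pmul => //; first by rewrite lee_fin coef_ge0.
  exact: Lnorm_ge0.
rewrite /Lp (_ : (f + g) \_ I = (f \_ I) \+ (g \_ I)).
  by apply: minkowski_EFin => //; exact: measfI.
apply/funext => t /=; rewrite !patchE; case: ifPn => // _.
by rewrite addr0.
Qed.

Lemma morrey_enormZ a f : measurable_fun U f -> (N (a *: f)%R = `|a|%:E * N f)%E.
Proof.
move=> mf; rewrite unlock -ereal_supZl//; last first.
  by apply/set0P; exists (term f U), U.
congr ereal_sup; rewrite image_comp; apply: eq_imagel => I sI /=.
rewrite !termE// muleCA; congr (_ * _)%E; rewrite !LpE.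
under eq_integral => t _ do rewrite [_ t]/= normrM powRM// EFinM.
rewrite ge0_integralZl_EFin ?powR_ge0//.
- rewrite poweRM ?lee_fin ?powR_ge0// poweR_EFin -powRrM mulfV ?gt_eqF//.
  by rewrite powRr1.
- exact: measI.
- apply/measurable_EFinP; apply: (measurableT_comp (measurable_powR _)) => //.
  apply: measurableT_comp => //.
  by case: (sI) => _ IU _; exact: measurable_funS mf.
Qed.

Lemma morrey_enorm_null f : measurable_fun U f ->
  {ae mu, forall t, U t -> f t = 0} -> N f = 0%E.
Proof.
move=> mf f0; apply/eqP; rewrite eq_le morrey_enorm_ge0 andbT.
apply: N_le => I sI; rewrite termE// LpE.
case: (sI) => _ IU _.
rewrite (ae_eq_integral (cst 0%E)) ?integral0 ?poweR0r ?mule0//.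
- by rewrite invr_neq0// gt_eqF.
- exact: measI.
- apply/measurable_EFinP; apply: (measurableT_comp (measurable_powR _)) => //.
  by apply: measurableT_comp => //; exact: measurable_funS mf.
- by apply: (@filterS _ _ (ae_filter_ringOfSetsType mu) _ _ _ f0) => t ft It /=; rewrite ft ?normr0 ?powR0 ?gt_eqF//; exact: IU.
Qed.

Lemma morrey_enorm_eq0 f : measurable_fun U f -> N f = 0%E ->
  {ae mu, forall t, U t -> f t = 0}.
Proof.
move=> mf N0; have : term f U = 0%E.
  apply/eqP; rewrite eq_le term_ge0// andbT -N0.
  exact: term_le.
rewrite termE// /coef muU/= w1 invr1 powR1 mul1r mul1e => L0.
have mfU : measurable_fun [set: measurableTypeR R] (EFin \o f \_ U).
  by apply/measurable_EFinP; exact: measfI.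
have p0 : (0 < p%:E)%E by rewrite lte_fin.
have := Lnorm_eq0_eq0 mfU p0 L0.
apply: (@filterS _ _ (ae_filter_ringOfSetsType mu)) => t /(_ I) /= [+] Ut.
by rewrite patchE mem_set.
Qed.

Lemma morrey_enorm_le1 f : measurable_fun U f -> (forall t, `|f t| <= 1) ->
  (N f <= 1)%E.
Proof.
move=> mf f1; apply: N_le => I sI; rewrite /morrey_term.
have le1 t : `|f t| `^ p <= 1.
  have <- : 1 `^ p = 1 :> R by rewrite powR1.
  by apply: ge0_ler_powR; rewrite ?nnegrE// ltW.
rewrite -[leRHS]mule1; apply: lee_pmul; rewrite ?lee_fin ?w_ge0 ?w_le1//.
  exact: poweR_ge0.
have <- : (1 `^ p^-1 = 1)%E by rewrite poweR_EFin powR1.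
apply: gt0_ler_poweR.
- by rewrite invr_ge0 ltW.
- by rewrite in_itv/= leey andbT mule_ge0// lee_fin invr_ge0 ltW// len_gt0.
- by rewrite in_itv/= leey andbT lee_fin ler01.
have -> : 1%E = ((fine (mu I))^-1%:E * \int[mu]_(t in I) (cst 1 t))%E.
  rewrite integral_cst; last exact: measI.
  rewrite mul1e -[X in (_ * X)%E](fineK (muI_fin sI)) -EFinM mulVf//.
  by rewrite gt_eqF// len_gt0.
apply: lee_pmul => //; first by rewrite lee_fin invr_ge0 ltW// len_gt0.
apply: ge0_le_integral => //.
- exact: measI.
- apply/measurable_EFinP; apply: (measurableT_comp (measurable_powR _)) => //.
  by apply: measurableT_comp => //; case: (sI) => _ IU _; exact: measurable_funS mf.
- by move=> t _; rewrite lee_fin; exact: le1.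
Qed.

Lemma morrey_submod_closed :
  submod_closed [pred f : R -> R | `[< measurable_fun U f /\ (N f < +oo)%E >]].
Proof.
have mZ a f : measurable_fun U f -> measurable_fun U (a *: f).
  by move=> mf; apply: measurable_funM => //; exact: measurable_cst.
split.
  apply/asboolP; split; first exact: measurable_cst.
  apply: le_lt_trans (ltry 1); apply: morrey_enorm_le1 => [|t].
    exact: measurable_cst.
  by rewrite normr0.
move=> a f g /asboolP[mf Nf] /asboolP[mg Ng]; apply/asboolP; split.
  exact: measurable_funD (mZ a f mf) mg.
apply: (le_lt_trans (morrey_enormD (mZ a f mf) mg)).
apply: lte_add_pinfty; last exact: Ng.
rewrite (morrey_enormZ a mf); apply: lte_mul_pinfty; last exact: Nf.
  by rewrite lee_fin.
by [].
Qed.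

End morrey_theory.

(* Functions are defined on the whole of R, but only their restrictions to    *)
(* [0, 1] matter: the values outside are irrelevant to membership, to the     *)
(* norm, and to the equivalence relation of the quotient.                     *)
Section morrey_space.
Context (R : realType) (p : R) (w : R -> R).
Context (p1 : 1 <= p) (qw : quasi_concave w) (w1 : w 1 = 1).
Local Notation mu := (@lebesgue_measure R).
Local Notation U := (`[0 : R, 1]%classic).
Local Notation N := (morrey_enorm p w).

(* The proofs are phantom arguments, needed to infer the module structure.    *)
Definition morrey_fun_pred (_ : 1 <= p) (_ : quasi_concave w) (_ : w 1 = 1) :
    {pred (R -> R)} :=
  [pred f : R -> R | `[< measurable_fun U f /\ (N f < +oo)%E >]].

HB.instance Definition _ := GRing.isSubmodClosed.Build R (R -> R)
  (morrey_fun_pred p1 qw w1) (morrey_submod_closed p1 qw w1).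

Record morrey_fun : Type := MorreyFun {
  morrey_val :> R -> R ;
  _ : morrey_val \in morrey_fun_pred p1 qw w1 }.

HB.instance Definition _ := [isSub for morrey_val].
HB.instance Definition _ := [Choice of morrey_fun by <:].
HB.instance Definition _ := [SubChoice_isSubLmodule of morrey_fun by <:].

Lemma morrey_funP (f : morrey_fun) : measurable_fun U f /\ (N f < +oo)%E.
Proof. by have /asboolP := valP f. Qed.

Definition morrey_null : {pred morrey_fun} :=
  [pred f : morrey_fun | `[< {ae mu, forall t, U t -> f t = 0} >]].

Lemma morrey_null_submod_closed : submod_closed morrey_null.
Proof.
split; first by apply/asboolP; exact: aeW.
move=> a f g /asboolP f0 /asboolP g0; apply/asboolP.
apply: (@filterS2 _ _ (ae_filter_ringOfSetsType mu) _ _ _ _ f0 g0) => t ft gt Ut.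
by rewrite /= [LHS](_ : _ = a * f t + g t)// ft// gt// mulr0 addr0.
Qed.

HB.instance Definition _ := GRing.isSubmodClosed.Build R morrey_fun
  morrey_null morrey_null_submod_closed.

Local Open Scope quotient_scope.

(* The Morrey space M_{p,w}: f and g are identified when f - g vanishes       *)
(* almost everywhere on [0, 1].                                               *)
Definition morrey : Type := {ideal_quot morrey_null}.

HB.instance Definition _ := GRing.Zmodule.on morrey.
HB.instance Definition _ := EqQuotient.on morrey.

Lemma eq_morreyP (f g : morrey_fun) :
  f = g %[mod morrey] <-> {ae mu, forall t, U t -> f t = g t}.
Proof.
have -> : f = g %[mod morrey] <-> f - g \in morrey_null.
  by rewrite Quotient.idealrBE; split => [->//|/eqP].
have ext : (forall t, f t = g t <-> (f - g) t = 0).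
  by move=> t; rewrite /= [X in _ <-> X = _](_ : _ = f t - g t)//; split=> [->|/subr0_eq//]; rewrite subrr.
split=> [/asboolP|h]; [|apply/asboolP; move: h];
  apply: (@filterS _ _ (ae_filter_ringOfSetsType mu)) => t h Ut; exact/ext/h.
Qed.

Let piD (f g : morrey_fun) :
  \pi_morrey (f + g)%R = \pi_morrey f + \pi_morrey g.
Proof. exact: Quotient.pi_add. Qed.

Definition morrey_scale (a : R) : morrey -> morrey :=
  lift_op1 morrey ( *:%R a).

Let piZ a (f : morrey_fun) : \pi_morrey (a *: f)%R = morrey_scale a (\pi_morrey f).
Proof.
unlock morrey_scale; apply/eqP; rewrite -Quotient.idealrBE -scalerBr; apply: rpredZ.
by rewrite Quotient.idealrBE reprK.
Qed.

Lemma morrey_scaleA a b x :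
  morrey_scale a (morrey_scale b x) = morrey_scale (a * b) x.
Proof. by elim/quotW: x => f; rewrite -!piZ scalerA. Qed.

Lemma morrey_scale1 : left_id 1 morrey_scale.
Proof. by elim/quotW=> f; rewrite -piZ scale1r. Qed.

Lemma morrey_scaleDr : right_distributive morrey_scale +%R.
Proof.
move=> a; elim/quotW=> f; elim/quotW=> g.
by rewrite -piD -!piZ -piD scalerDr.
Qed.

Lemma morrey_scaleDl x : {morph morrey_scale^~ x : a b / a + b}.
Proof. by move=> a b; elim/quotW: x => f; rewrite -!piZ -piD scalerDl. Qed.

HB.instance Definition _ := GRing.Zmodule_isLmodule.Build R morrey
  morrey_scaleA morrey_scale1 morrey_scaleDr morrey_scaleDl.

Definition morrey_norm (x : morrey) : R := fine (N (repr x)).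

Lemma morrey_normE (f : morrey_fun) : (morrey_norm (\pi_morrey f))%:E = N f.
Proof.
have le_N (g h : morrey_fun) : g = h %[mod morrey] -> (N g <= N h)%E.
  move=> /eqP; rewrite -Quotient.idealrBE => /asboolP gh0.
  have /= mgh := (morrey_funP (g - h)).1.
  have := morrey_enormD p1 qw (morrey_funP h).1 mgh.
  rewrite (morrey_enorm_null p1 qw mgh gh0) adde0; congr (N _ <= _)%E.
  by apply/funext => t /=; rewrite [LHS](_ : _ = h t + (g t - h t))// addrC subrK.
have <- : N (repr (\pi_morrey f)) = N f.
  by apply/eqP; rewrite eq_le !le_N ?reprK.
rewrite fineK// ge0_fin_numE; last exact: (morrey_enorm_ge0 p1 qw).
exact: (morrey_funP _).2.
Qed.

Lemma morrey_normD (x y : morrey) :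
  morrey_norm (x + y) <= morrey_norm x + morrey_norm y.
Proof.
elim/quotW: x => f; elim/quotW: y => g.
rewrite -piD -lee_fin EFinD !morrey_normE.
exact: (morrey_enormD p1 qw (morrey_funP f).1 (morrey_funP g).1).
Qed.

Lemma morrey_normZ a (x : morrey) :
  morrey_norm (a *: x) = `|a| * morrey_norm x.
Proof.
elim/quotW: x => f; apply: EFin_inj; rewrite EFinM morrey_normE.
have -> : a *: \pi_morrey f = \pi_morrey (a *: f)%R by rewrite piZ.
by rewrite morrey_normE; exact: (morrey_enormZ w p1 a (morrey_funP f).1).
Qed.

Lemma morrey_norm0_eq0 (x : morrey) : morrey_norm x = 0 -> x = 0.
Proof.
move=> x0; have N0 : N (repr x) = 0%E by rewrite -morrey_normE reprK x0.
have <- : \pi_morrey 0%R = 0 by apply: (addrI (\pi_morrey 0%R)); rewrite -piD !addr0.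
rewrite -[x]reprK; apply/eqP; rewrite -Quotient.idealrBE subr0; apply/asboolP.
exact: (morrey_enorm_eq0 p1 qw w1 (morrey_funP _).1 N0).
Qed.

HB.instance Definition _ := Lmodule_isNormed.Build R morrey
  morrey_normD morrey_normZ morrey_norm0_eq0.

Definition rademacher (k : nat) (t : R) : R := Num.sg (sin (2 ^+ k * pi * t)).

Lemma measurable_rademacher k : measurable_fun [set: R] (rademacher k).
Proof.
have msg : measurable_fun [set: R] (Num.sg : R -> R).
  apply: measurable_fun_ifT => //; first exact: measurable_fun_eqr.
  by apply: measurable_fun_ifT => //; exact: measurable_fun_ltr.
apply: (measurableT_comp msg); apply: measurableT_comp.
  by apply: continuous_measurable_fun; exact: continuous_sin.
exact: measurable_funM.
Qed.

Lemma rademacher_in k : rademacher k \in morrey_fun_pred p1 qw w1.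
Proof.
have mr : measurable_fun U (rademacher k).
  exact: measurable_funS (measurable_rademacher k).
apply/asboolP; split=> //; apply: le_lt_trans (ltry 1).
by apply: (morrey_enorm_le1 p1 qw w1) => // t; rewrite normr_sg lern1 leq_b1.
Qed.

Definition morrey_rademacher (k : nat) : morrey :=
  \pi_morrey (MorreyFun (rademacher_in k)).

(* The Rademacher system starts at k = 1. *)
Definition rademacher_span : set morrey :=
  closed_span [set morrey_rademacher k | k in [set k | (0 < k)%N]].

End morrey_space.

Arguments rademacher_span {R p w} p1 qw w1.
Arguments morrey_rademacher {R p w} p1 qw w1 k.

(* Main.v *)
From HB Require Import structures.
Require Import Defs.
From mathcomp Require Import all_boot all_order all_algebra.
From mathcomp Require Import all_classical all_reals all_analysis.
From mathcomp Require Import measurable_realfun ring lra.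

Set Implicit Arguments.
Unset Strict Implicit.
Unset Printing Implicit Defensive.

Import Order.TTheory GRing.Theory Num.Theory.
Import numFieldNormedType.Exports.

Local Open Scope classical_set_scope.
Local Open Scope ring_scope.

(** On a dyadic interval of length 2^-m the first m terms of a sum of a_k r_k are
    constant, and the other ones behave like a sum with independent random signs. By
    Khinchine's inequalities (sign_average_powR_le, sign_average_powR_ge_l2) the p-th mean
    of the sum over this interval is therefore comparable to the absolute value of the
    constant plus the l_2 norm of the remaining coefficients, and the constant equals
    |a_1| + ... + |a_m| on a suitable interval. As any interval is covered by two dyadic
    intervals of comparable length, the Morrey norm of the sum is equivalent to the
    larger of the two quantities

      (sum_k a_k^2)^(1/2)   and   sup_m w(2^-m) (|a_1| + ... + |a_m|)

    (morrey_enorm_ge_l2, morrey_enorm_ge_l1, morrey_enorm_le).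

    The dichotomy (l2_or_complemented_c0) follows from this equivalence, from w(2^-m) -> 0
    and from the completeness of the Morrey space (seq_complete_morrey). If the first
    quantity is equivalent to the norm on X, then X carries a complete scalar product and
    an orthonormal basis identifies it with l_2 (hilbert_subspace_isomorphic_l2).

    Otherwise X contains unit vectors whose first quantity is arbitrarily small, and whose
    norm is therefore due to the second one. For a vector x of the span with coefficients
    a, the number w(2^-m) (|a_1| + ... + |a_m|) tends to 0 as m grows, because w(2^-m)
    does. A gliding hump thus yields unit vectors x_i of X with small l_2 parts, for which
    these numbers are of order 1 at some m_i and summably small for m outside disjoint
    windows around the m_i. Then b -> sum_i b_i x_i is bounded from c_0 to X, and the
    functionals g_i which compute the second quantity of x_i at the level m_i form a
    bounded operator G from the span to c_0, with G T close to the identity of c_0 if T is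
    the former operator. Inverting G T (near_identity_inverse) gives both the inverse of T
    and the projection T (G T)^-1 G onto its range, a complemented copy of c_0 in X. *)

(** * Complete normed spaces *)

Lemma ler_of_sqr (R : realDomainType) (a b : R) : 0 <= b -> a ^+ 2 <= b ^+ 2 -> a <= b.
Proof. by move=> b0; case: (lerP a b) => // ab; rewrite leNgt ltrXn2r ?nnegrE// ltW. Qed.

Section completeness.
Context (R : realType).
Implicit Types (E F : normedModType R).

(** Sequential and in epsilon form, as the estimates below produce it. *)
Definition seq_complete E : Prop := forall u : nat -> E,
  (forall eps : R, 0 < eps -> exists N, forall m n,
    (N <= m)%N -> (N <= n)%N -> `|u m - u n| <= eps) ->
  exists l : E, u @ \oo --> l.

Lemma seq_cvgP E (u : nat -> E) (l : E) :
  u @ \oo --> l <->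
  (forall eps : R, 0 < eps -> exists N, forall n, (N <= n)%N -> `|u n - l| <= eps).
Proof.
split=> [/cvgrPdist_le ul eps e0|ul].
  have [N _ hN] := ul _ e0; exists N => n Nn.
  by rewrite distrC; apply: hN.
apply/cvgrPdist_le => eps /ul [N hN].
by exists N => // n /= Nn; rewrite distrC; apply: hN.
Qed.

Lemma seq_complete_real : seq_complete R^o.
Proof.
move=> u cu; apply/cvg_ex/cauchy_cvgP/cauchy_ballP => e e0.
have [N hN] := cu (e / 2) (divr_gt0 e0 (ltr0n _ 2)).
exists (u @` [set n | (N <= n)%N], u @` [set n | (N <= n)%N]).
  by split; exists N => // n /= Nn; exists n.
move=> [_ _] /= [[m Nm <-] [n Nn <-]].
rewrite -ball_normE /ball_/=; apply: le_lt_trans (hN _ _ Nm Nn) _; lra.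
Qed.

Lemma linear_lipschitz_continuous E F (f : {linear E -> F}) (C : R) :
  (forall x, `|f x| <= C * `|x|) -> continuous f.
Proof.
move=> fC; apply/bounded_linear_continuous/bounded_funP => r.
exists (`|C| * r) => x xr; apply: (le_trans (fC x)).
apply: (@le_trans _ _ (`|C| * `|x|)); last exact: ler_wpM2l.
by apply: ler_wpM2r => //; exact: ler_norm.
Qed.

Lemma mk_linear E F (f : E -> F) :
  (forall (a : R) x y, f (a *: x + y) = a *: f x + f y) ->
  exists g : {linear E -> F}, forall x, g x = f x.
Proof.
move=> fl; have lf : linear f by [].
pose g : {linear E -> F} := HB.pack f (GRing.isLinear.Build R E F *:%R f lf).
by exists g.
Qed.

(** The inverse of an isomorphism onto a subspace is only controlled on that subspace. *)
Lemma lipschitz_within_continuous E F (X : set E) (f : E -> F) (C : R) :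
  (forall x y, X x -> X y -> `|f x - f y| <= C * `|x - y|) ->
  {within X, continuous f}.
Proof.
move=> fC; apply/subspace_continuousP => x Xx; apply/cvgrPdist_le => e e0.
have C1 : 0 < `|C| + 1 by rewrite ltr_wpDl.
rewrite near_withinE.
have : nbhs x (ball x (e / (`|C| + 1))) by apply: nbhsx_ballx; rewrite divr_gt0.
apply: filterS => y; rewrite -ball_normE /= ltr_pdivlMr// => xy Xy.
apply: (le_trans (fC x y Xx Xy)); apply: le_trans (ltW xy).
rewrite mulrC ler_wpM2l//; have := ler_norm C; lra.
Qed.

Lemma seq_cvg_unique E (u : nat -> E) (a b : E) :
  u @ \oo --> a -> u @ \oo --> b -> a = b.
Proof. exact: (@cvg_unique _ (@norm_hausdorff _ E)). Qed.

Lemma real_cvg_unique (u : nat -> R) (a b : R) :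
  u @ \oo --> a -> u @ \oo --> b -> a = b.
Proof. exact: (@seq_cvg_unique R^o). Qed.

Lemma seq_cvg_norm_le E (u : nat -> E) (l : E) (M : R) :
  u @ \oo --> l -> (\forall n \near \oo, `|u n| <= M) -> `|l| <= M.
Proof.
move=> ul uM; have nul : `|u n| @[n --> \oo] --> `|l| by exact: cvg_norm.
rewrite -(cvg_lim _ nul)//; apply: limr_le => //; first by apply/cvg_ex; exists `|l|.
Qed.

Lemma closed_seq E (A : set E) (u : nat -> E) (l : E) :
  closed A -> u @ \oo --> l -> (forall n, A (u n)) -> A l.
Proof. by move=> cA ul Au; apply: (closed_cvg A cA _ _ ul); apply: nearW. Qed.

Lemma closure_seq E (A : set E) (l : E) :
  closure A l -> exists2 u : nat -> E, (forall n, A (u n)) & u @ \oo --> l.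
Proof.
move=> Al; have H n : exists x, A x /\ `|x - l| <= n.+1%:R^-1.
  have [|x [Ax xl]] := Al (ball l n.+1%:R^-1); first exact: nbhsx_ballx.
  exists x; split=> //; rewrite distrC ltW//.
  by move: xl; rewrite -ball_normE.
pose u n := projT1 (cid (H n)); exists u.
  by move=> n; case: (projT2 (cid (H n))).
apply/seq_cvgP => e e0; have [N _ hN] := near_infty_natSinv_lt (PosNum e0).
exists N => n Nn; have [_ h] := projT2 (cid (H n)).
by apply: le_trans h _; apply/ltW/hN.
Qed.

End completeness.

Section subspaces.
Context (R : realType) (E : normedModType R).
Implicit Types (X : set E).

Lemma subspace0 X : linear_subspace X -> X 0.
Proof. by move=> [X0 _]; move: X0; rewrite in_setE. Qed.

Lemma subspaceP X (a : R) (x y : E) : linear_subspace X ->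
  X x -> X y -> X (a *: x + y).
Proof. by move=> [_ h] Xx Xy; have := h a x y; rewrite !in_setE; apply. Qed.

Lemma subspaceD X (x y : E) : linear_subspace X -> X x -> X y -> X (x + y).
Proof. by move=> sX Xx Xy; rewrite -[x]scale1r; apply: subspaceP. Qed.

Lemma subspaceZ X (a : R) (x : E) : linear_subspace X -> X x -> X (a *: x).
Proof.
by move=> sX Xx; rewrite -[_ *: _]addr0; apply: subspaceP => //; apply: subspace0.
Qed.

Lemma subspaceB X (x y : E) : linear_subspace X -> X x -> X y -> X (x - y).
Proof. by move=> sX Xx Xy; rewrite addrC -scaleN1r; apply: subspaceP. Qed.

Lemma subspace_sum X {I : Type} {r : seq I} {P : pred I} {f : I -> E} :
  linear_subspace X -> (forall i, P i -> X (f i)) -> X (\sum_(i <- r | P i) f i).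
Proof.
move=> sX Xf; elim/big_ind: _ => [|x y|i Pi]; [exact: subspace0| |exact: Xf].
exact: subspaceD.
Qed.

Lemma mk_subspace X : X 0 -> (forall (a : R) x y, X x -> X y -> X (a *: x + y)) ->
  linear_subspace X.
Proof.
by move=> X0 XP; split=> [|a x y]; rewrite ?in_setE// => Xx Xy; apply: XP.
Qed.

End subspaces.

(** * Perturbing the identity *)

Section near_identity.
Context (R : realType).

Lemma dist_half_powers (E : normedModType R) (u : nat -> E) (C : R) :
  (forall n, `|u n.+1 - u n| <= C / 2 ^+ n) ->
  forall n k, `|u (n + k)%N - u n| <= 2 * C / 2 ^+ n - 2 * C / 2 ^+ (n + k).
Proof.
move=> hu n; elim=> [|k IH]; first by rewrite addn0 !subrr normr0.
rewrite addnS; have -> : u (n + k).+1 - u n =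
  (u (n + k).+1 - u (n + k)%N) + (u (n + k)%N - u n) by rewrite addrA subrK.
apply: (le_trans (ler_normD _ _)).
have := hu (n + k)%N; move: IH.
set q := C / 2 ^+ (n + k).
have -> : 2 * C / 2 ^+ (n + k).+1 = q by rewrite /q exprS; field; exact: expf_neq0.
have -> : 2 * C / 2 ^+ (n + k) = 2 * q by rewrite /q mulrA.
lra.
Qed.

Lemma half_powers_small (C e : R) : 0 < e -> exists N, forall n, (N <= n)%N -> C / 2 ^+ n <= e.
Proof.
move=> e0.
have : C * (2^-1 ^+ n) @[n --> \oo] --> C * 0.
  by apply: cvgMl_tmp; apply: cvg_expr; rewrite gtr0_norm ?invr_gt0// invf_lt1// ltr1n.
rewrite mulr0 => /cvgr0_norm_le/(_ _ e0) [N _ hN]; exists N => n /hN /=.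
by rewrite exprVn; apply: le_trans; exact: ler_norm.
Qed.

Lemma seq_complete_half_powers (E : normedModType R) (u : nat -> E) (C : R) :
  seq_complete E -> (forall n, `|u n.+1 - u n| <= C / 2 ^+ n) ->
  exists l : E, u @ \oo --> l.
Proof.
move=> cE hu; apply: cE => e e0.
have C0 : 0 <= C by have := le_trans (normr_ge0 _) (hu 0%N); rewrite expr0 divr1.
have [N hN] := half_powers_small (4 * C) e0; exists N => m n Nm Nn.
have tail k : (N <= k)%N -> `|u k - u N| <= 2 * C / 2 ^+ N.
  move=> Nk; have := dist_half_powers hu N (k - N); rewrite subnKC// => /le_trans; apply.
  by rewrite gerBl// !mulr_ge0// invr_ge0 exprn_ge0.
have -> : u m - u n = (u m - u N) - (u n - u N) by rewrite opprB addrA subrK.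
apply: le_trans (hN N (leqnn _)); apply: (le_trans (ler_normB _ _)).
have := tail _ Nm; have := tail _ Nn; rewrite -!mulrA; lra.
Qed.

(** Neumann series in iterative form: u (n + 1) = u n + (b - A (u n)) solves A x = b,
    because A - 1 halves the residue b - A (u n) at each step. *)
Lemma near_identity_inverse (F : normedModType R) (A : {linear F -> F}) :
  seq_complete F -> (forall x, `|A x - x| <= `|x| / 2) ->
  exists B : F -> F, [/\ cancel A B, cancel B A, (forall a x y, B (a *: x + y) = a *: B x + B y)
                       & forall y, `|B y| <= 2 * `|y|].
Proof.
move=> cF hA.
have low x : `|x| <= 2 * `|A x|.
  have := hA x; rewrite distrC => h2.
  have : `|x| <= `|x - A x| + `|A x| by rewrite -[X in `|X| <= _](subrK (A x)); exact: ler_normD.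
  lra.
have Ainj : injective A.
  move=> x y xy; apply/eqP; rewrite -subr_eq0 -normr_le0.
  by have := low (x - y); rewrite linearB xy subrr normr0 mulr0.
have Acont : continuous A.
  apply: (@linear_lipschitz_continuous _ _ _ _ 2) => x.
  have : `|A x| <= `|A x - x| + `|x| by rewrite -[X in `|X| <= _](subrK x); exact: ler_normD.
  by have := hA x; have := normr_ge0 x; lra.
have surj b : exists x, A x = b.
  pose u := fix u n := if n is m.+1 then u m + (b - A (u m)) else 0 : F.
  have res n : `|b - A (u n)| <= `|b| / 2 ^+ n.
    elim: n => [|n IH]; first by rewrite /= linear0 subr0 expr0 divr1.
    rewrite /= linearD opprD addrA -normrN opprB.
    apply: (le_trans (hA _)); rewrite exprS invfM mulrCA mulrC.
    by rewrite ler_wpM2l.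
  have [|x ux] := @seq_complete_half_powers _ u `|b| cF.
    by move=> n; rewrite /= [u n + _]addrC addrK.
  exists x; apply: (@seq_cvg_unique _ _ (A \o u)); first by apply: (continuous_cvg _ (Acont x) ux).
  apply/seq_cvgP => e e0; have [N hN] := half_powers_small `|b| e0.
  by exists N => n Nn /=; rewrite distrC; apply: le_trans (res n) (hN n Nn).
pose B b := projT1 (cid (surj b)).
have BK : cancel B A by move=> b; rewrite /B; case: cid.
exists B; split => //.
- by move=> x; apply: Ainj; rewrite BK.
- by move=> a x y; apply: Ainj; rewrite linearP !BK.
- by move=> y; have := low (B y); rewrite BK.
Qed.

End near_identity.

(** * The sequence space c_0 *)

Section c0_facts.
Context (R : realType).
Implicit Types (x y : c0 R).

Definition mk_c0 (x : nat -> R) (cx : x @ \oo --> (0 : R)) : c0 R :=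
  @C0 R x (asboolT cx).

Lemma c0_cvg x : (x : nat -> R) @ \oo --> (0 : R).
Proof. by have /asboolP := valP x. Qed.

Lemma c0_ext x y : (forall n, x n = y n) -> x = y.
Proof. by move=> xy; apply/val_inj/funext. Qed.

Lemma c0_coord_le x n : `|x n| <= `|x|.
Proof. exact: c0_norm_ub. Qed.

Lemma c0_norm_leP x (M : R) : (forall n, `|x n| <= M) -> `|x| <= M.
Proof. exact: c0_norm_le. Qed.

Lemma c0_subE x y n : (x - y) n = x n - y n.
Proof. by []. Qed.

Lemma seq_complete_c0 : seq_complete (c0 R).
Proof.
move=> u cu.
have lims k : exists l : R, u n k @[n --> \oo] --> l.
  apply: (@seq_complete_real R) => e e0; have [N hN] := cu e e0.
  exists N => m n Nm Nn; apply: le_trans (hN _ _ Nm Nn).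
  exact: (c0_coord_le (u m - u n)).
pose l k := projT1 (cid (lims k)).
have ul k : u n k @[n --> \oo] --> l k by rewrite /l; case: cid.
have unif e : 0 < e -> exists N, forall n k, (N <= n)%N -> `|u n k - l k| <= e.
  move=> e0; have [N hN] := cu e e0; exists N => n k Nn.
  apply: (@seq_cvg_norm_le _ R^o (fun m => u n k - u m k)).
    by apply: cvgB => //; exact: cvg_cst.
  exists N => // m /= Nm; apply: le_trans (hN _ _ Nn Nm).
  exact: (c0_coord_le (u n - u m)).
have l0 : l @ \oo --> (0 : R).
  apply/(@seq_cvgP _ R^o) => e e0; have e20 : 0 < e / 2 by rewrite divr_gt0.
  have [N hN] := unif _ e20.
  have [M hM] := iffLR (@seq_cvgP R R^o _ _) (@c0_cvg (u N)) _ e20.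
  exists M => k Mk; rewrite subr0; have := hM k Mk; have := hN N k (leqnn _).
  rewrite subr0 distrC => h1 h2.
  have : `|l k| <= `|l k - u N k| + `|u N k|.
    by rewrite -[X in `|X| <= _](subrK (u N k)); exact: ler_normD.
  lra.
exists (mk_c0 l0); apply/seq_cvgP => e e0; have [N hN] := unif e e0.
by exists N => n Nn; apply: c0_norm_leP => k; exact: hN.
Qed.

End c0_facts.

(** * The sequence space l_2 *)

Section l2_facts.
Context (R : realType).
Implicit Types (x y : l2 R).

Let pow2 (a : R) : (`|a%:E| `^ 2 = (a ^+ 2)%:E)%E.
Proof. by rewrite abse_EFin poweR_EFin powR_mulrn// -normrX ger0_norm ?sqr_ge0. Qed.

(** All the facts on l_2 below follow from this formula, which replaces the integral
    with respect to the counting measure by a series. *)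
Lemma l2_norm_sqr x : ((`|x| ^+ 2)%:E = \sum_(k <oo) ((x k) ^+ 2)%:E)%E.
Proof.
have h : (`|x|%:E = 'N[counting]_2%:E[EFin \o x])%E by exact: finite_norm_fine.
have {h} h := congr1 (fun z => z `^ 2)%E h.
rewrite powR_Lnorm// ge0_integral_count in h; last by move=> k; exact: poweR_ge0.
rewrite -pow2 abse_EFin normr_id h; apply: eq_eseriesr => k _; exact: pow2.
Qed.

Lemma l2_partial_le x n : \sum_(k < n) (x k) ^+ 2 <= `|x| ^+ 2.
Proof.
rewrite -lee_fin l2_norm_sqr -(big_mkord xpredT (fun k => (x k) ^+ 2)) -sumEFin.
by apply: nneseries_lim_ge => i _ _; rewrite lee_fin sqr_ge0.
Qed.

Let series_le (x : nat -> R) (M : R) :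
  (forall n, \sum_(k < n) (x k) ^+ 2 <= M) -> (\sum_(k <oo) ((x k) ^+ 2)%:E <= M%:E)%E.
Proof.
move=> xM; apply: lime_le.
  by apply: is_cvg_nneseries => i _ _; rewrite lee_fin sqr_ge0.
by apply: nearW => n; rewrite sumEFin lee_fin big_mkord.
Qed.

Lemma l2_norm_leP x (M : R) : 0 <= M ->
  (forall n, \sum_(k < n) (x k) ^+ 2 <= M ^+ 2) -> `|x| <= M.
Proof.
move=> M0 xM; rewrite -(@ler_pXn2r _ 2)// ?nnegrE//.
by rewrite -lee_fin l2_norm_sqr; exact: series_le.
Qed.

Lemma mk_l2 (x : nat -> R) (M : R) :
  (forall n, \sum_(k < n) (x k) ^+ 2 <= M) -> exists y : l2 R, forall k, y k = x k.
Proof.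
move=> xM.
have xin : x \in Lfun (@counting nat R) 2%:E.
  apply/andP; split; rewrite inE; first by [].
  rewrite /= /finite_norm Lnorm_counting//.
  apply: poweR_lty; apply: le_lt_trans (ltry M).
  by under eq_eseriesr do rewrite pow2; exact: series_le.
by exists (Lfun_Sub (lee1n 2) xin).
Qed.

Lemma l2_ext x y : (forall n, x n = y n) -> x = y.
Proof. by move=> xy; apply/val_inj/funext. Qed.

End l2_facts.

(** * Infinite-dimensional closed subspaces with a Hilbert norm *)

(** Used twice: for the Cauchy-Schwarz inequality (e = B x x), and to show that an
    approximate minimiser of B is approximately orthogonal to the directions in which
    it can be moved (e = the excess over the minimum). *)
Lemma discriminant_le (R : realType) (e b q : R) : 0 <= q ->
  (forall t, 0 <= e + 2 * t * b + t ^+ 2 * q) -> b ^+ 2 <= e * q.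
Proof.
move=> q0 h; have [q00|qn] := eqVneq q 0.
  rewrite q00 mulr0; have [->|bn] := eqVneq b 0; first by rewrite expr0n.
  have e0 : 0 <= e by have := h 0; rewrite mulr0 mul0r expr0n /= mul0r !addr0.
  have := h (- (e + 1) / (2 * b)); rewrite q00 mulr0 addr0.
  have -> : e + 2 * (- (e + 1) / (2 * b)) * b = - 1 by field.
  by rewrite lerNr oppr0 ler10.
have qp : 0 < q by rewrite lt_neqAle eq_sym qn.
have := h (- b / q).
have -> : e + 2 * (- b / q) * b + (- b / q) ^+ 2 * q = (e * q - b ^+ 2) / q by field.
by rewrite pmulr_lge0 ?invr_gt0// subr_ge0.
Qed.

Section hilbert_subspace.
Context (R : realType) (E : normedModType R) (cE : seq_complete E).
Context (X : set E) (sX : linear_subspace X) (clX : closed X).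
Context (B : E -> E -> R) (c C : R).
(** B is a scalar product on X whose norm is equivalent to the one of E, and f is a
    separating sequence of functionals. The latter plays the part of a dense sequence of
    vectors: the orthonormal basis below is adapted to its kernels. *)
Context (B_lin : forall a x y z, X x -> X y -> X z ->
  B (a *: x + y) z = a * B x z + B y z).
Context (B_sym : forall x y, X x -> X y -> B x y = B y x).
Context (norm_le_B : forall x, X x -> `|x| ^+ 2 <= c * B x x).
Context (C_ge0 : 0 <= C) (B_le_norm : forall x, X x -> B x x <= (C * `|x|) ^+ 2).
Context (f : nat -> E -> R).
Context (f_lin : forall k a x y, X x -> X y -> f k (a *: x + y) = a * f k x + f k y).
Context (f_le : forall k x, X x -> f k x ^+ 2 <= B x x).
Context (f_sep : forall x, X x -> (forall k, f k x = 0) -> x = 0).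

Let X0 := subspace0 sX.
Let XP a x y := @subspaceP R E X a x y sX.
Let XB x y := @subspaceB R E X x y sX.
Let XZ a x := @subspaceZ R E X a x sX.

Let BB0 x : X x -> 0 <= B x x.
Proof. by move=> Xx; apply: le_trans (f_le 0%N Xx); exact: sqr_ge0. Qed.

Let B0l z : X z -> B 0 z = 0.
Proof.
move=> Xz; have := B_lin 0 X0 X0 Xz; rewrite scaler0 addr0 mul0r add0r.
by have := B_lin 1 X0 X0 Xz; rewrite scaler0 addr0 mul1r => h _; lra.
Qed.

Let BZl a x z : X x -> X z -> B (a *: x) z = a * B x z.
Proof. by move=> Xx Xz; rewrite -[a *: x]addr0 B_lin// B0l// addr0. Qed.

Let BBl x y z : X x -> X y -> X z -> B (x - y) z = B x z - B y z.
Proof. by move=> Xx Xy Xz; rewrite addrC -scaleN1r B_lin// mulN1r addrC. Qed.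

Let qD a x y : X x -> X y ->
  B (a *: x + y) (a *: x + y) = a ^+ 2 * B x x + 2 * a * B x y + B y y.
Proof.
move=> Xx Xy; have Xz := XP a Xx Xy; rewrite B_lin// (B_sym Xx)// (B_sym Xy)// !B_lin//.
by rewrite (B_sym Xy Xx); ring.
Qed.

Let cauchy_schwarz x y : X x -> X y -> B x y ^+ 2 <= B x x * B y y.
Proof.
move=> Xx Xy; rewrite mulrC; apply: discriminant_le; first exact: BB0.
move=> t; have := BB0 (XP t Xx Xy); rewrite qD//.
by lra.
Qed.

Let c_gt0_or x : X x -> x != 0 -> 0 < c.
Proof.
move=> Xx xn; have := norm_le_B Xx; have := BB0 Xx.
rewrite le_eqVlt => /orP[/eqP <-|Bp].
  by rewrite mulr0 leNgt exprn_gt0// normr_gt0.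
move=> h; rewrite -(pmulr_lgt0 _ Bp); apply: lt_le_trans h.
by rewrite exprn_gt0// normr_gt0.
Qed.

Let B_cvg (u : nat -> E) l y : (forall n, X (u n)) -> X y -> u @ \oo --> l ->
  B (u n) y @[n --> \oo] --> B l y.
Proof.
move=> Xu Xy ul; have Xl : X l := closed_seq clX ul Xu.
apply/(@seq_cvgP R R^o) => e e0.
have D0 : 0 < C * (C * `|y|) + 1 by rewrite ltr_wpDl// !mulr_ge0.
have [N hN] := iffLR (seq_cvgP _ _) ul _ (divr_gt0 e0 D0); exists N => n Nn.
have Xd := XB (Xu n) Xl.
rewrite -BBl//; have := cauchy_schwarz Xd Xy => cs.
have {}cs : B (u n - l) y ^+ 2 <= ((C * `|u n - l|) * (C * `|y|)) ^+ 2.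
  by apply: (le_trans cs); rewrite exprMn; apply: ler_pM; rewrite ?BB0// B_le_norm.
apply: ler_of_sqr; [exact: ltW|rewrite real_normK ?num_real//].
apply: (le_trans cs); rewrite lerXn2r ?nnegrE ?mulr_ge0//; try exact: ltW.
have := hN n Nn; rewrite ler_pdivlMr// => h.
apply: le_trans h; have -> : C * `|u n - l| * (C * `|y|) = `|u n - l| * (C * (C * `|y|)) by ring.
by rewrite ler_wpM2l// lerDl.
Qed.

Let fB k x y : X x -> X y -> f k (x - y) = f k x - f k y.
Proof. by move=> Xx Xy; rewrite addrC -scaleN1r f_lin// mulN1r addrC. Qed.

Let f0 k : f k 0 = 0.
Proof. by have := fB k X0 X0; rewrite !subrr. Qed.

Let fZ k a x : X x -> f k (a *: x) = a * f k x.
Proof. by move=> Xx; rewrite -[_ *: _]addr0 f_lin// f0 addr0. Qed.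

Let f_cvg k (u : nat -> E) l : (forall n, X (u n)) -> u @ \oo --> l ->
  f k (u n) @[n --> \oo] --> f k l.
Proof.
move=> Xu ul; have Xl : X l := closed_seq clX ul Xu.
apply/(@seq_cvgP R R^o) => e e0.
have D0 : 0 < C + 1 by rewrite ltr_wpDl.
have [N hN] := iffLR (seq_cvgP _ _) ul _ (divr_gt0 e0 D0); exists N => n Nn.
have Xd := XB (Xu n) Xl; rewrite -fB//.
apply: ler_of_sqr; [exact: ltW|rewrite real_normK ?num_real//].
apply: (le_trans (f_le k Xd)); apply: (le_trans (B_le_norm Xd)).
rewrite lerXn2r ?nnegrE ?mulr_ge0//; try exact: ltW.
have := hN n Nn; rewrite ler_pdivlMr// => h; apply: le_trans h.
by rewrite mulrC ler_wpM2l// lerDl.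
Qed.

(** Each term has codimension at most 1 in the preceding one, so that an orthonormal
    basis is obtained by taking a unit vector of each Xk k orthogonal to Xk k.+1. *)
Let Xk k := [set x | X x /\ forall j, (j < k)%N -> f j x = 0].

Let XkP k a x y : Xk k x -> Xk k y -> Xk k (a *: x + y).
Proof.
move=> [Xx fx] [Xy fy]; split; first exact: XP.
by move=> j jk; rewrite f_lin// fx// fy// mulr0 addr0.
Qed.

Let XkS k x : Xk k x -> f k x = 0 -> Xk k.+1 x.
Proof.
move=> [Xx fx] fkx; split=> // j; rewrite ltnS leq_eqVlt => /orP[/eqP->//|].
exact: fx.
Qed.

Let SXk k x : Xk k.+1 x -> Xk k x.
Proof. by move=> [Xx fx]; split=> // j jk; apply: fx; apply: ltnW. Qed.

(** The vector of minimal norm in the affine hyperplane f k = 1 of Xk k is orthogonal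
    to Xk k.+1. The parallelogram identity makes minimising sequences Cauchy. *)
Let riesz_step k : (exists2 x, Xk k x & f k x != 0) ->
  exists e, [/\ Xk k e, B e e = 1, f k e != 0 & forall y, Xk k.+1 y -> B e y = 0].
Proof.
move=> [x0 Xx0 fx0].
pose S := [set x | Xk k x /\ f k x = 1].
have S0 : S ((f k x0)^-1 *: x0).
  have [Xx fx] := Xx0; split; last by rewrite fZ// mulVf.
  by split=> [|j jk]; [exact: XZ|rewrite fZ// (fx j jk) mulr0].
pose d := inf [set B x x | x in S].
have dlb : has_lbound [set B x x | x in S].
  by exists 0 => _ [x [[Xx _] _] <-]; exact: BB0.
have d_le x : S x -> d <= B x x.
  by move=> Sx; apply: ge_inf => //; exists x.
have near_min n : exists x, S x /\ B x x <= d + n.+1%:R^-1.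
  have n0 : 0 < n.+1%:R^-1 :> R by [].
  have [|_ [x Sx <-] xd] := @inf_adherent _ [set B x x | x in S] _ n0.
    by split=> //; exists (B ((f k x0)^-1 *: x0) ((f k x0)^-1 *: x0)), ((f k x0)^-1 *: x0).
  by exists x; split => //; exact: ltW.
pose u n := projT1 (cid (near_min n)).
have Su n : S (u n) by rewrite /u; case: cid => ? [].
have ud n : B (u n) (u n) <= d + n.+1%:R^-1 by rewrite /u; case: cid => ? [].
have Xu n : X (u n) by have [[]] := Su n.
have c0 : 0 < c.
  have [Xx _] := Xx0; apply: (c_gt0_or Xx).
  by apply: contra_neq fx0 => ->; rewrite f0.
have par m n : `|u m - u n| ^+ 2 <= c * (2 * m.+1%:R^-1 + 2 * n.+1%:R^-1).
  apply: (le_trans (norm_le_B (XB (Xu m) (Xu n)))); rewrite ler_pM2l//.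
  have Smid : S (2^-1 *: (1 *: u m + u n)).
    have [Xm fm] := Su m; have [Xn fn] := Su n.
    have Xmn := XkP 1 Xm Xn; have [XX fX] := Xmn.
    split; last by rewrite fZ// f_lin// fm fn; lra.
    by split=> [|j jk]; [exact: XZ|rewrite fZ// fX// mulr0].
  have := d_le _ Smid.
  have -> : u m - u n = (-1) *: u n + u m by rewrite scaleN1r addrC.
  have Xmn : X (1 *: u m + u n) by exact: XP.
  have Xmid := XZ 2^-1 Xmn.
  rewrite BZl// (B_sym Xmn Xmid) BZl//.
  rewrite !qD// (B_sym (Xu n) (Xu m)); have := ud m; have := ud n.
  by set a := m.+1%:R^-1; set b := n.+1%:R^-1; rewrite expr1n sqrrN expr1n; lra.
have [z uz] : exists z : E, u @ \oo --> z.
  apply: cE => e e0.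
  have e1 : 0 < e ^+ 2 / (4 * c) by rewrite divr_gt0 ?exprn_gt0// mulr_gt0.
  have [N _ hN] := near_infty_natSinv_lt (PosNum e1).
  exists N => m n Nm Nn; apply: ler_of_sqr; [exact: ltW|].
  apply: (le_trans (par m n)).
  have := ltW (hN _ Nm); have := ltW (hN _ Nn) => /=.
  rewrite !ler_pdivlMr ?mulr_gt0//; set a := _^-1; set b := _^-1; lra.
have Xz : X z := closed_seq clX uz Xu.
have fz j : (j <= k)%N -> f j z = (j == k)%:R.
  move=> jk; have h := @f_cvg j u z Xu uz; apply: (real_cvg_unique h).
  apply: cvg_near_cst; apply: nearW => n; have [[_ fn] fkn] := Su n.
  move: jk; rewrite leq_eqVlt => /orP[/eqP->|jk]; first by rewrite eqxx.
  by rewrite fn// ltn_eqF.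
have Bz y : Xk k.+1 y -> B z y = 0.
  move=> Xy; have [XXy fy] := Xy.
  have bnd n : B (u n) y ^+ 2 <= n.+1%:R^-1 * B y y.
    apply: discriminant_le; first exact: BB0.
    move=> t; have St : S (t *: y + u n).
      have [Xn fn] := Su n; split; first by apply: XkP => //; exact: SXk.
      by rewrite f_lin// fy// fn mulr0 add0r.
    have := d_le _ St; rewrite qD// (B_sym XXy (Xu n)); have := ud n.
    by set a := n.+1%:R^-1; lra.
  apply: (real_cvg_unique (B_cvg Xu XXy uz)).
  apply/(@seq_cvgP R R^o) => e e0.
  have D0 : 0 < B y y + 1 by rewrite ltr_wpDl// BB0.
  have e1 : 0 < e ^+ 2 / (B y y + 1) by rewrite divr_gt0 ?exprn_gt0.
  have [N _ hN] := near_infty_natSinv_lt (PosNum e1); exists N => n Nn.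
  rewrite subr0; apply: ler_of_sqr; [exact: ltW|rewrite real_normK ?num_real//].
  apply: (le_trans (bnd n)); have := ltW (hN _ Nn); rewrite /= ler_pdivlMr// => h.
  by apply: le_trans h; rewrite ler_wpM2l// lerDl.
have fkz : f k z = 1 by rewrite fz// eqxx.
have Bzz : 0 < B z z by apply: lt_le_trans (f_le k Xz); rewrite fkz expr1n.
have s0 : Num.sqrt (B z z) != 0 by rewrite gt_eqF// sqrtr_gt0.
exists ((Num.sqrt (B z z))^-1 *: z); split.
- split=> [|j jk]; first exact: XZ.
  by rewrite fZ// (fz j (ltnW jk)) ltn_eqF// mulr0.
- have Xe := XZ (Num.sqrt (B z z))^-1 Xz.
  rewrite (BZl _ Xz Xe) (B_sym Xz Xe) (BZl _ Xz Xz) mulrA -expr2 exprVn.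
  by rewrite sqr_sqrtr ?mulVf ?gt_eqF// ltW.
- by rewrite fZ// fkz mulr1 invr_eq0.
- by move=> y Xy; have [XXy _] := Xy; rewrite BZl// (Bz _ Xy) mulr0.
Qed.

Let A : set nat := [set k | exists2 x, Xk k x & f k x != 0].

Let e k : E := if pselect (A k) is left Ak then projT1 (cid (riesz_step Ak)) else 0.

Let eP k : A k ->
  [/\ Xk k (e k), B (e k) (e k) = 1, f k (e k) != 0 & forall y, Xk k.+1 y -> B (e k) y = 0].
Proof. by move=> Ak; rewrite /e; case: pselect => // Ak'; case: cid. Qed.

Let Xe k : A k -> X (e k).
Proof. by move=> /eP[[]]. Qed.

Let Xk_le k l x : (k <= l)%N -> Xk l x -> Xk k x.
Proof. by move=> kl [Xx fx]; split=> // j jk; apply: fx; apply: leq_trans kl. Qed.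

Let e_lt k l : A k -> A l -> (k < l)%N -> B (e k) (e l) = 0.
Proof.
move=> Ak Al kl; have [_ _ _] := eP Ak; apply.
by apply: (Xk_le kl); have [] := eP Al.
Qed.

Let e_orth k l : A k -> A l -> B (e k) (e l) = (k == l)%:R.
Proof.
move=> Ak Al; case: ltngtP => [kl|lk|<-]; first exact: e_lt.
  by rewrite B_sym; [exact: e_lt|exact: Xe..].
by have [] := eP Ak.
Qed.

(** A vector orthogonal to every e k goes down the whole filtration, hence is killed
    by all the functionals. *)
Let e_total x : X x -> (forall k, A k -> B (e k) x = 0) -> x = 0.
Proof.
move=> Xx Bx; suff Xkx k : Xk k x.
  by apply: f_sep => // k; have [_] := Xkx k.+1; apply.
elim: k => [|k IH]; first by split.
apply: XkS => //; apply/eqP; apply/negPn/negP => fkx.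
have Ak : A k by exists x.
have [Xek Bek fek ek] := eP Ak; have [XXek _] := Xek.
have Xy : Xk k.+1 (- (f k x / f k (e k)) *: e k + x).
  apply: XkS; first exact: XkP.
  by rewrite f_lin// mulNr divfK// addNr.
have := ek _ Xy; have [XXy _] := Xy.
rewrite B_sym// B_lin// Bek mulr1 (B_sym Xx XXek) Bx// addr0.
move=> /eqP; rewrite oppr_eq0 mulf_eq0 invr_eq0 (negbTE fkx)/= => /eqP fe0.
by rewrite fe0 eqxx in fek.
Qed.

Let B_suml (I : Type) (r : seq I) (P : pred I) (a : I -> R) (v : I -> E) z :
  (forall i, P i -> X (v i)) -> X z ->
  B (\sum_(i <- r | P i) a i *: v i) z = \sum_(i <- r | P i) a i * B (v i) z.
Proof.
move=> Xv Xz; suff [] : X (\sum_(i <- r | P i) a i *: v i) /\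
    B (\sum_(i <- r | P i) a i *: v i) z = \sum_(i <- r | P i) a i * B (v i) z by [].
elim/big_rec2: _ => [|i s x Pi [Xx Bx]]; first by split; [|exact: B0l].
split; first exact: XP (Xv _ Pi) _.
by rewrite B_lin// ?Bx//; exact: Xv.
Qed.

(** If A were finite, then subtracting from x its finitely many components would leave
    a vector orthogonal to every e k, so that X would be spanned by the e k. *)
Let A_infinite : ~ finite_dimensional X -> infinite_set A.
Proof.
move=> infX finA; apply: infX.
have [r rA] := iffLR (finite_seqP A) finA.
exists (e @` A); first exact: finite_image.
have Ae : e @` A `<=` X by move=> _ [k Ak <-]; exact: Xe.
apply/seteqP; split => x; last first.
  by move=> [n [a [v [Av ->]]]]; apply: (subspace_sum sX) => i _; apply/XZ/Ae/Av.
move=> Xx.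
pose s := undup r.
have sA k : k \in s -> A k by move=> ks; rewrite rA /= -mem_undup.
exists (size s), (fun i => B (e (nth 0%N s i)) x), (fun i => e (nth 0%N s i)); split.
  by move=> i; exists (nth 0%N s i) => //; apply/sA/mem_nth.
rewrite -(big_mkord xpredT (fun i => B (e (nth 0%N s i)) x *: e (nth 0%N s i))).
rewrite -(big_nth 0%N xpredT (fun k => B (e k) x *: e k)) big_seq.
apply/eqP; rewrite -subr_eq0; apply/eqP.
have XS : X (\sum_(k <- s | k \in s) B (e k) x *: e k).
  by apply: (subspace_sum sX) => k /sA Ak; apply/XZ/Xe.
apply: e_total; first exact: XB.
move=> k Ak; have Xek := Xe Ak.
rewrite B_sym//; last exact: XB.
rewrite BBl// B_suml//; last by move=> l /sA; exact: Xe.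
have ks : k \in s by move: Ak; rewrite rA /= -mem_undup.
rewrite -big_seq (bigD1_seq k)//= ?undup_uniq//.
rewrite e_orth// eqxx mulr1 big_seq_cond big1 ?addr0.
  by rewrite (B_sym Xx)// subrr.
by move=> l /andP[/sA Al lk]; rewrite e_orth// (negbTE lk) mulr0.
Qed.

(** The orthonormal system enumerated by s is total, and X is complete: this is the
    Riesz-Fischer theorem, the inverse of the isomorphism being given by the Fourier
    coefficients, which are square-summable by Bessel's inequality. *)
Lemma hilbert_subspace_isomorphic_l2 : ~ finite_dimensional X -> isomorphic X (l2 R).
Proof.
move=> infX.
have /card_esym/card_set_bijP[s sbij] := eq_card_nat (countableP A) (A_infinite infX).
have [sfun sinj ssurj] := sbij.
have As n : A (s n) by apply: sfun.
pose v n := e (s n).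
have Xv n : X (v n) by exact: Xe.
have vo m n : B (v m) (v n) = (m == n)%:R.
  rewrite e_orth//; suff -> : (s m == s n) = (m == n) by [].
  by apply/eqP/eqP => [smn|->//]; apply: sinj => //; rewrite in_setE.
have v_total x : X x -> (forall n, B (v n) x = 0) -> x = 0.
  move=> Xx Bx; apply: e_total => // k Ak.
  by have [n _ <-] := ssurj k Ak; exact: Bx.
have XS (a : nat -> R) r : X (\sum_(i <- r) a i *: v i).
  by apply: (subspace_sum sX) => i _; exact: XZ.
have BS (a : nat -> R) (r : seq nat) j : uniq r ->
    B (\sum_(i <- r) a i *: v i) (v j) = if j \in r then a j else 0.
  move=> ur; rewrite B_suml//; case: ifPn => jr.
    rewrite (bigD1_seq j)//= vo eqxx mulr1 big1 ?addr0// => i ij.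
    by rewrite vo (negbTE ij) mulr0.
  rewrite big_seq big1// => i ir; rewrite vo; case: eqP => [ij|_]; last by rewrite mulr0.
  by rewrite -ij ir in jr.
have qS (a : nat -> R) (r : seq nat) : uniq r ->
    B (\sum_(i <- r) a i *: v i) (\sum_(i <- r) a i *: v i) = \sum_(i <- r) a i ^+ 2.
  move=> ur; rewrite B_suml// !big_seq; apply: eq_bigr => i ir.
  by rewrite -big_seq B_sym// BS// ir -expr2.
have bessel x n : X x -> \sum_(i < n) (B x (v i)) ^+ 2 <= B x x.
  move=> Xx; rewrite -(big_mkord xpredT (fun i => B x (v i) ^+ 2)).
  have := BB0 (XP (-1) (XS (fun i => B x (v i)) (index_iota 0 n)) Xx).
  rewrite qD// qS ?iota_uniq// sqrrN expr1n mul1r B_suml//.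
  under [X in _ + _ * _ * X + _]eq_bigr => i _ do rewrite (B_sym (Xv i) Xx) -expr2.
  by set t := \sum_(_ <= i < _) _; move=> h; lra.
have cvgT (a : l2 R) : exists x : E, (fun n => \sum_(0 <= i < n) a i *: v i) @ \oo --> x.
  apply: cE => eps eps0.
  have c0 : 0 <= c.
    have Bv : B (v 0%N) (v 0%N) = 1 by rewrite vo.
    have := norm_le_B (Xv 0%N); rewrite Bv mulr1; apply: le_trans; exact: sqr_ge0.
  have tail m n : (m <= n)%N ->
      `|\sum_(0 <= i < n) a i *: v i - \sum_(0 <= i < m) a i *: v i| ^+ 2 <=
      c * (\sum_(0 <= i < n) a i ^+ 2 - \sum_(0 <= i < m) a i ^+ 2).
    move=> mn; rewrite !(big_cat_nat (leq0n m) mn)/=.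
    rewrite [X in `|X|]addrC addrA addNr add0r [X in c * X]addrC addrA addNr add0r.
    by apply: (le_trans (norm_le_B (XS _ _))); rewrite qS ?iota_uniq.
  have ndS : nondecreasing_seq (fun n => \sum_(0 <= i < n) a i ^+ 2).
    move=> m n mn; rewrite (big_cat_nat (leq0n m) mn)/= lerDl sumr_ge0// => i _.
    exact: sqr_ge0.
  have cS : cvgn (fun n => \sum_(0 <= i < n) a i ^+ 2).
    apply: nondecreasing_is_cvgn => //; exists (`|a| ^+ 2) => _ [n _ <-].
    by rewrite big_mkord; exact: l2_partial_le.
  have e1 : 0 < eps ^+ 2 / (c + 1) / 2 by rewrite !divr_gt0// ?exprn_gt0// ltr_wpDl.
  have [N hN] := iffLR (@seq_cvgP R R^o _ _) cS _ e1.
  have main m n : (N <= m)%N -> (m <= n)%N ->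
      `|\sum_(0 <= i < n) a i *: v i - \sum_(0 <= i < m) a i *: v i| <= eps.
    move=> Nm mn; apply: ler_of_sqr; first exact: ltW.
    apply: (le_trans (tail m n mn)).
    have := hN _ Nm; have := hN _ (leq_trans Nm mn).
    set l := limn _; set t1 := \sum_(0 <= i < n) _; set t2 := \sum_(0 <= i < m) _.
    move=> h1 h2.
    have h : t1 - t2 <= eps ^+ 2 / (c + 1).
      by move: h1 h2; rewrite !ler_norml => /andP[_ h1] /andP[h2 _]; lra.
    have c1 : 0 < c + 1 by rewrite ltr_wpDl.
    move: h; rewrite ler_pdivlMr// => h; apply: le_trans h.
    have /ndS : (m <= n)%N by []. 
    rewrite -/t1 -/t2 => h; rewrite mulrC ler_wpM2l ?subr_ge0// lerDl//.
  exists N => m n Nm Nn; case: (leqP m n) => [mn|/ltnW nm].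
    by rewrite distrC; exact: main.
  exact: main.
pose T0 a := projT1 (cid (cvgT a)).
have T0P (a : l2 R) : (fun n => \sum_(0 <= i < n) a i *: v i) @ \oo --> T0 a.
  by rewrite /T0; case: cid.
have XT (a : l2 R) : X (T0 a) by apply: (closed_seq clX (T0P a)) => n; exact: XS.
have [T TE] : exists T : {linear l2 R -> E}, forall x, T x = T0 x.
  apply: mk_linear => a x y; apply: (seq_cvg_unique (T0P _)).
  have -> : (fun n => \sum_(0 <= i < n) (a *: x + y) i *: v i) =
      (fun n => a *: (\sum_(0 <= i < n) x i *: v i) + \sum_(0 <= i < n) y i *: v i).
    apply/funext => n; rewrite scaler_sumr -big_split/=; apply: eq_bigr => i _.
    by rewrite -[LHS]/((a * x i + y i) *: v i) scalerDl scalerA.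
  exact: cvgD (cvgZl_tmp (T0P x)) (T0P y).
have BT (a : l2 R) j : B (T0 a) (v j) = a j.
  apply: (real_cvg_unique (B_cvg (fun n => XS a (index_iota 0 n)) (Xv j) (T0P a))).
  apply: cvg_near_cst; exists j.+1 => // n /= jn.
  by rewrite BS ?iota_uniq// mem_index_iota jn.
have S_ex y : exists z : l2 R, X y -> forall j, z j = B y (v j).
  have [Xy|nXy] := pselect (X y); last by exists 0.
  by have [z zE] := @mk_l2 R (fun j => B y (v j)) _ (fun n => bessel y n Xy); exists z.
pose S y := projT1 (cid (S_ex y)).
have SE y : X y -> forall j, S y j = B y (v j) by rewrite /S; case: cid.
have TS y : X y -> T0 (S y) = y.
  move=> Xy; apply/eqP; rewrite -subr_eq0; apply/eqP; apply: v_total.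
    exact: XB.
  by move=> n; rewrite B_sym//; [rewrite BBl// BT SE// subrr|exact: XB].
exists T, S; split.
- apply: (@linear_lipschitz_continuous _ _ _ _ (`|c| + 1)) => a.
  rewrite TE; apply: ler_of_sqr; first by rewrite mulr_ge0// addr_ge0.
  have h n : `|\sum_(0 <= i < n) a i *: v i| <= (`|c| + 1) * `|a|.
    apply: ler_of_sqr; first by rewrite mulr_ge0// addr_ge0.
    apply: (le_trans (norm_le_B (XS _ _))); rewrite qS ?iota_uniq// big_mkord.
    have := l2_partial_le a n; set t := \sum_(_ < _) _ => ta.
    have t0 : 0 <= t by rewrite sumr_ge0// => i _; exact: sqr_ge0.
    apply: (@le_trans _ _ ((`|c| + 1) ^+ 2 * t)); last by rewrite exprMn ler_wpM2l// sqr_ge0.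
    rewrite ler_wpM2r//; have := ler_norm c; have := normr_ge0 c; nra.
  rewrite ler_pXn2r ?nnegrE ?mulr_ge0// ?addr_ge0//.
  by apply: (seq_cvg_norm_le (T0P a)); apply: nearW.
- apply/seteqP; split => [_ [a _ <-]|y Xy]; first by rewrite TE.
  by exists (S y) => //; rewrite TE TS.
- by move=> a; apply: l2_ext => j; rewrite TE SE// BT.
- apply: (@lipschitz_within_continuous _ _ _ _ _ C) => x y Xx Xy.
  have -> : S x - S y = S (x - y).
    apply: l2_ext => j; rewrite SE ?BBl//; last exact: XB.
    by rewrite -[LHS]/(S x j - S y j) !SE.
  have Xxy := XB Xx Xy; apply: l2_norm_leP; first exact: mulr_ge0.
  move=> n; apply: le_trans (B_le_norm Xxy).
  by under eq_bigr do rewrite SE//; exact: bessel.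
Qed.

End hilbert_subspace.

(** * Systems equivalent to the Rademacher system *)

Lemma cvg_bigsum (R : realType) (I : Type) (r : seq I) (u : I -> nat -> R) (l : I -> R) :
  (forall i, u i n @[n --> \oo] --> l i) ->
  \sum_(i <- r) u i n @[n --> \oo] --> \sum_(i <- r) l i.
Proof.
move=> ul; elim: r => [|i r IH].
  rewrite big_nil; apply: cvg_near_cst; apply: nearW => n; exact: big_nil.
rewrite big_cons; under eq_fun do rewrite big_cons.
by apply: cvgD.
Qed.

Lemma real_cvg_le (R : realType) (u : nat -> R) (l t : R) :
  u @ \oo --> l -> (\forall n \near \oo, u n <= t) -> l <= t.
Proof. by move=> ul h; rewrite -(cvg_lim _ ul)//; apply: limr_le => //; apply/cvg_ex; exists l. Qed.

Lemma real_cvg_ge (R : realType) (u : nat -> R) (l t : R) :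
  u @ \oo --> l -> (\forall n \near \oo, t <= u n) -> t <= l.
Proof. by move=> ul h; rewrite -(cvg_lim _ ul)//; apply: limr_ge => //; apply/cvg_ex; exists l. Qed.

(** Minkowski's inequality for squares of norms, in the form needed for an induction:
    expand the square and use 2 u v <= (t / s) u^2 + (s / t) v^2. *)
Lemma sqsum_add_le (R : realType) (u v : nat -> R) (s t : R) n : 0 < s -> 0 < t ->
  \sum_(k < n) u k ^+ 2 <= s ^+ 2 -> \sum_(k < n) v k ^+ 2 <= t ^+ 2 ->
  \sum_(k < n) (u k + v k) ^+ 2 <= (s + t) ^+ 2.
Proof.
move=> s0 t0 us vt.
have sn0 : s != 0 by rewrite gt_eqF. have tn0 : t != 0 by rewrite gt_eqF.
apply: (@le_trans _ _ (\sum_(k < n) ((1 + t / s) * u k ^+ 2 + (1 + s / t) * v k ^+ 2))).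
  apply: ler_sum => k _; rewrite -subr_ge0.
  have -> : (1 + t / s) * u k ^+ 2 + (1 + s / t) * v k ^+ 2 - (u k + v k) ^+ 2 =
    (t * u k - s * v k) ^+ 2 / (s * t) by field; rewrite sn0 tn0.
  by rewrite divr_ge0 ?sqr_ge0// mulr_ge0// ltW.
rewrite big_split/= -!mulr_sumr.
have -> : (s + t) ^+ 2 = (1 + t / s) * s ^+ 2 + (1 + s / t) * t ^+ 2.
  by field; rewrite sn0 tn0.
by apply: lerD; apply: ler_wpM2l => //; rewrite addr_ge0// divr_ge0// ltW.
Qed.

Lemma sum_truncate (V : zmodType) (F : nat -> V) N n : (N <= n)%N ->
  \sum_(k < n) (if (k < N)%N then F k else 0) = \sum_(k < N) F k.
Proof. by move=> Nn; rewrite (big_ord_widen n F Nn) [RHS]big_mkcond. Qed.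

Section basis.
Context (R : realType) (E : normedModType R) (cE : seq_complete E).
Context (e : nat -> E) (W : nat -> R) (W_ge0 : forall m, 0 <= W m).
Context (W_cvg0 : W @ \oo --> (0 : R)) (K : R) (K_ge1 : 1 <= K).

Definition psum n (a : nat -> R) : E := \sum_(k < n) a k *: e k.

(** The three hypotheses say that the norm of a finite sum with coefficients a is
    equivalent to the larger of the l_2 norm of a and of the supremum over m of
    W m * (|a 0| + ... + |a (m - 1)|). This norm is monotone in the |a k|, which makes
    e an unconditional basis of its closed span Z. *)
Context (l2_le_norm : forall n (a : nat -> R), \sum_(k < n) a k ^+ 2 <= (K * `|psum n a|) ^+ 2).
Context (l1_le_norm : forall m n (a : nat -> R), (m <= n)%N ->
  W m * \sum_(k < m) `|a k| <= K * `|psum n a|).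
Context (norm_le : forall M (a : nat -> R), 0 < M -> (forall n, \sum_(k < n) a k ^+ 2 <= M ^+ 2) ->
  (forall m, W m * \sum_(k < m) `|a k| <= M) -> forall n, `|psum n a| <= K * M).

Let K_gt0 : 0 < K. Proof. exact: lt_le_trans K_ge1. Qed.
Let K_ge0 : 0 <= K. Proof. exact: ltW. Qed.

Let Z : set E := closed_span (range e).

Let psum_lin n c (a b : nat -> R) : psum n (fun k => c * a k + b k) = c *: psum n a + psum n b.
Proof.
rewrite /psum scaler_sumr -big_split/=; apply: eq_bigr => i _.
by rewrite scalerDl scalerA.
Qed.

Let expands (x : E) (a : nat -> R) := psum n a @[n --> \oo] --> x.

Let expands_lin c x y (a b : nat -> R) : expands x a -> expands y b ->
  expands (c *: x + y) (fun k => c * a k + b k).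
Proof.
move=> xa yb; rewrite /expands; under eq_fun do rewrite psum_lin.
exact: cvgD (cvgZl_tmp xa) yb.
Qed.

Arguments expands_lin c {x y a b} _ _.

Let KnormX x (a : nat -> R) : expands x a ->
  (K * `|psum n a|) ^+ 2 @[n --> \oo] --> (K * `|x|) ^+ 2.
Proof.
move=> xa; have h : K * `|psum n a| @[n --> \oo] --> K * `|x|.
  by apply: cvgMl_tmp; exact: cvg_norm.
exact: (cvgM h h).
Qed.

Let expands_l2 x (a : nat -> R) n : expands x a -> \sum_(k < n) a k ^+ 2 <= (K * `|x|) ^+ 2.
Proof.
move=> xa; apply: (real_cvg_ge (KnormX xa)); exists n => // N /= nN.
apply: le_trans (l2_le_norm N a).
rewrite -!(big_mkord xpredT (fun k => a k ^+ 2)) (big_cat_nat (leq0n n) nN)/= lerDl.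
by apply: sumr_ge0 => i _; exact: sqr_ge0.
Qed.

Let expands_l1 x (a : nat -> R) m : expands x a -> W m * \sum_(k < m) `|a k| <= K * `|x|.
Proof.
move=> xa; have h : K * `|psum n a| @[n --> \oo] --> K * `|x|.
  by apply: cvgMl_tmp; exact: cvg_norm.
by apply: (real_cvg_ge h); exists m => // N /= mN; exact: l1_le_norm.
Qed.

Let expands_norm_le x (a : nat -> R) M : expands x a -> 0 < M ->
  (forall n, \sum_(k < n) a k ^+ 2 <= M ^+ 2) ->
  (forall m, W m * \sum_(k < m) `|a k| <= M) -> `|x| <= K * M.
Proof.
move=> xa M0 h2 h1; apply: (seq_cvg_norm_le xa); apply: nearW => n; exact: norm_le.
Qed.

Let expands_coord_le x (a : nat -> R) k : expands x a -> `|a k| <= K * `|x|.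
Proof.
move=> xa; apply: ler_of_sqr; first exact: mulr_ge0.
rewrite real_normK ?num_real//; apply: le_trans (expands_l2 k.+1 xa).
by rewrite big_ord_recr/= lerDr; apply: sumr_ge0 => i _; exact: sqr_ge0.
Qed.

Let expands_sub x y (a b : nat -> R) : expands x a -> expands y b ->
  expands (x - y) (fun k => a k - b k).
Proof.
move=> xa yb; have := expands_lin (-1) yb xa; rewrite scaleN1r addrC.
by under eq_fun do rewrite mulN1r addrC.
Qed.

Let expands_unique x (a b : nat -> R) : expands x a -> expands x b -> a = b.
Proof.
move=> xa xb; apply/funext => k; apply/eqP; rewrite -subr_eq0 -normr_le0.
by have := expands_coord_le k (expands_sub xa xb); rewrite subrr normr0 mulr0.
Qed.

(** Stated with an eventually constant expansion, so that the coefficients of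
    approximating finite sums can be compared coordinate by coordinate. *)
Let span_expands x : lin_span (range e) x ->
  exists a N, forall n, (N <= n)%N -> psum n a = x.
Proof.
pose V := [set x | exists a N, forall n, (N <= n)%N -> psum n a = x].
have sV : linear_subspace V.
  apply: mk_subspace.
    by exists (fun=> 0), 0%N => n _; rewrite /psum big1// => i _; rewrite scale0r.
  move=> c u v [a [N aN]] [b [M bM]]; exists (fun k => c * a k + b k), (maxn N M) => n.
  by rewrite geq_max => /andP[Nn Mn]; rewrite psum_lin aN// bM.
have Ve k : V (e k).
  exists (fun j => (j == k)%:R), k.+1 => n kn; rewrite /psum (bigD1 (Ordinal kn))//=.
  rewrite eqxx scale1r big1 ?addr0// => i ik.
  by rewrite (_ : (i == k :> nat) = false) ?scale0r//; apply: negbTE.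
move=> [n [a [v [ev ->]]]]; apply: (subspace_sum sV) => i _.
by apply: subspaceZ => //; have [k _ <-] := ev i.
Qed.

Let span_psum n a : lin_span (range e) (psum n a).
Proof. by exists n, (fun i => a i), (fun i : 'I_n => e i); split=> // i; exists (i : nat). Qed.

(** The coefficients of a converging sequence of finite sums converge, and the bounds
    for the coefficients of their differences survive in the limit. *)
Let expands_exists x : Z x -> exists a, expands x a.
Proof.
move=> /closure_seq [s ss sx].
pose c j := projT1 (cid (span_expands (ss j))).
have cP j : exists N, forall n, (N <= n)%N -> psum n (c j) = s j.
  by rewrite /c; case: cid.
have ex j : expands (s j) (c j).
  by have [N h] := cP j; apply: cvg_near_cst; exists N => // n /= /h ->.
have cauchy_s eps : 0 < eps -> exists N, forall i j, (N <= i)%N -> (N <= j)%N ->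
    `|s i - s j| <= eps /\ `|s i - x| <= eps.
  move=> eps0; have [N hN] := iffLR (seq_cvgP _ _) sx _ (divr_gt0 eps0 (ltr0n _ 2)).
  exists N => i j Ni Nj; have hi := hN i Ni; have hj := hN j Nj; split; last lra.
  have := ler_normB (s i - x) (s j - x); rewrite opprB addrA subrK; lra.
have lims k : exists l : R, c j k @[j --> \oo] --> l.
  apply: (@seq_complete_real R) => eps eps0.
  have [N hN] := cauchy_s _ (divr_gt0 eps0 K_gt0); exists N => m n Nm Nn.
  apply: (le_trans (expands_coord_le k (expands_sub (ex m) (ex n)))).
  by rewrite mulrC -ler_pdivlMr//; have [] := hN m n Nm Nn.
pose a k := projT1 (cid (lims k)).
have ca k : c j k @[j --> \oo] --> a k by rewrite /a; case: cid.
exists a; apply/seq_cvgP => eps eps0.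
have D0 : 0 < K * K + 1 by rewrite ltr_wpDl// mulr_ge0.
pose d := eps / (K * K + 1); have d0 : 0 < d by rewrite divr_gt0.
have [J hJ] := cauchy_s _ d0.
have Kd0 : 0 < K * d by rewrite mulr_gt0.
have difnorm n : `|psum n (fun k => (-1) * c J k + a k)| <= K * (K * d).
  apply: norm_le => // {}n.
    apply: (@real_cvg_le _ (fun i => \sum_(k < n) ((-1) * c J k + c i k) ^+ 2)).
      apply: (@cvg_bigsum R 'I_n (index_enum _) (fun k i => ((-1) * c J k + c i k) ^+ 2)).
      move=> k; have h : (-1) * c J k + c i k @[i --> \oo] --> (-1) * c J k + a k.
        by apply: cvgD (ca k); exact: cvg_cst.
      exact: (cvgM h h).
    exists J => // i /= Ji.
    have := expands_l2 n (expands_lin (-1) (ex J) (ex i)); move/le_trans; apply.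
    apply: lerXn2r; [by rewrite nnegrE mulr_ge0|by rewrite nnegrE ltW|].
    by rewrite ler_wpM2l// scaleN1r addrC; have [] := hJ i J Ji (leqnn _).
  apply: (@real_cvg_le _ (fun i => W n * \sum_(k < n) `|(-1) * c J k + c i k|)).
    apply: cvgMl_tmp.
    apply: (@cvg_bigsum R 'I_n (index_enum _) (fun k i => `|(-1) * c J k + c i k|)).
    by move=> k; apply: cvg_norm; apply: cvgD (ca k); exact: cvg_cst.
  exists J => // i /= Ji.
  have := expands_l1 n (expands_lin (-1) (ex J) (ex i)); move/le_trans; apply.
  by rewrite ler_wpM2l// scaleN1r addrC; have [] := hJ i J Ji (leqnn _).
have [N hN] := cP J; exists N => n Nn.
have := difnorm n; rewrite psum_lin scaleN1r hN// addrC => h1.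
have [_ h2] := hJ J J (leqnn _) (leqnn _).
have -> : psum n a - x = (psum n a - s J) + (s J - x) by rewrite addrA subrK.
apply: (le_trans (ler_normD _ _)).
have -> : eps = K * (K * d) + d by rewrite /d; field; rewrite gt_eqF.
exact: lerD.
Qed.

Let expands_Z x a : expands x a -> Z x.
Proof.
move=> xa; apply: (closed_seq (@closed_closure _ _) xa) => n.
exact: subset_closure (span_psum n a).
Qed.

Let Z_subspace : linear_subspace Z.
Proof.
apply: mk_subspace.
  apply: (@expands_Z _ (fun=> 0)); apply: cvg_near_cst; apply: nearW => n.
  by rewrite /psum big1// => i _; rewrite scale0r.
move=> c x y /expands_exists[a xa] /expands_exists[b yb].
exact: expands_Z (expands_lin c xa yb).
Qed.

Definition coef (x : E) : nat -> R :=
  if pselect (Z x) is left Zx then projT1 (cid (expands_exists Zx)) else fun=> 0.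

Let coefP x : Z x -> expands x (coef x).
Proof. by rewrite /coef; case: pselect => // Zx _; case: cid. Qed.

Let coef_lin c x y k : Z x -> Z y -> coef (c *: x + y) k = c * coef x k + coef y k.
Proof.
move=> Zx Zy.
have h := expands_lin c (coefP Zx) (coefP Zy).
by rewrite (expands_unique (coefP (subspaceP c Z_subspace Zx Zy)) h).
Qed.

Let coef_sep x : Z x -> (forall k, coef x k = 0) -> x = 0.
Proof.
move=> Zx x0; apply: (seq_cvg_unique (coefP Zx)); apply: cvg_near_cst; apply: nearW => n.
by rewrite /psum big1// => i _; rewrite x0 scale0r.
Qed.

Let dot x y := limn (fun n => \sum_(k < n) coef x k * coef y k).

Let sq_cvg x : Z x -> cvgn (fun n => \sum_(k < n) coef x k ^+ 2).
Proof.
move=> Zx; apply: nondecreasing_is_cvgn; last first.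
  by exists ((K * `|x|) ^+ 2) => _ [n _ <-]; exact: expands_l2 (coefP Zx).
apply/nondecreasing_seqP => n; rewrite big_ord_recr/= lerDl; exact: sqr_ge0.
Qed.

(** By polarisation, since the partial sums of squares are monotone and bounded. *)
Let dot_cvg x y : Z x -> Z y ->
  \sum_(k < n) coef x k * coef y k @[n --> \oo] --> dot x y.
Proof.
move=> Zx Zy; rewrite /dot.
have Zxy := subspaceP 1 Z_subspace Zx Zy.
pose s z n := \sum_(k < n) coef z k ^+ 2.
have h : 2^-1 * (s (1 *: x + y) n - s x n - s y n) @[n --> \oo] -->
    2^-1 * (limn (s (1 *: x + y)) - limn (s x) - limn (s y)).
  by apply: cvgMl_tmp; apply: cvgB; [apply: cvgB|]; exact: sq_cvg.
suff <- : (fun n => 2^-1 * (s (1 *: x + y) n - s x n - s y n)) =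
    (fun n => \sum_(k < n) coef x k * coef y k) by exact: (cvgP _ h).
apply/funext => n; rewrite -!sumrB mulr_sumr; apply: eq_bigr => k _.
by rewrite coef_lin//; field.
Qed.

Let dot_partial x n : Z x -> \sum_(k < n) coef x k ^+ 2 <= dot x x.
Proof.
move=> Zx; apply: (real_cvg_ge (dot_cvg Zx Zx)); exists n => // N /= nN.
rewrite -(big_mkord xpredT (fun k => coef x k ^+ 2)).
rewrite -(big_mkord xpredT (fun k => coef x k * coef x k)) (big_cat_nat (leq0n n) nN)/=.
rewrite [leLHS](_ : _ = \sum_(0 <= i < n) coef x i * coef x i); last first.
  by apply: eq_bigr => i _; rewrite expr2.
by rewrite lerDl; apply: sumr_ge0 => i _; rewrite -expr2 sqr_ge0.
Qed.

Section subspace_of_span.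
Context (X : set E) (XZ : X `<=` Z) (sX : linear_subspace X) (clX : closed X).

Lemma isomorphic_l2_of_l2_equivalent (c : R) : ~ finite_dimensional X ->
  (forall x, X x -> `|x| ^+ 2 <= c * dot x x) -> isomorphic X (l2 R).
Proof.
move=> infX hc.
apply: (@hilbert_subspace_isomorphic_l2 _ _ cE _ sX clX dot c K _ _ hc K_ge0 _
  (fun k x => coef x k)) => //.
- move=> a x y z /XZ Zx /XZ Zy /XZ Zz.
  have Zxy := subspaceP a Z_subspace Zx Zy.
  apply: (real_cvg_unique (dot_cvg Zxy Zz)).
  have h : a * (\sum_(k < n) coef x k * coef z k) + \sum_(k < n) coef y k * coef z k
      @[n --> \oo] --> a * dot x z + dot y z.
    by apply: cvgD; [apply: cvgMl_tmp|]; exact: dot_cvg.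
  apply: cvg_trans h; apply: near_eq_cvg; apply: nearW => n /=.
  rewrite mulr_sumr -big_split/=; apply: eq_bigr => k _.
  by rewrite coef_lin// mulrDl mulrA.
- move=> x y _ _; congr (limn _); apply/funext => n; apply: eq_bigr => k _.
  exact: mulrC.
- move=> x /XZ Zx; apply: (real_cvg_le (dot_cvg Zx Zx)); apply: nearW => n.
  by under eq_bigr do rewrite -expr2; exact: expands_l2 (coefP Zx).
- by move=> k a x y /XZ Zx /XZ Zy; exact: coef_lin.
- move=> k x /XZ Zx; apply: le_trans (dot_partial k.+1 Zx).
  by rewrite big_ord_recr/= lerDr; apply: sumr_ge0 => i _; exact: sqr_ge0.
- by move=> x /XZ Zx; exact: coef_sep.
Qed.

Let coef0 k : coef 0 k = 0.
Proof.
have Z0 := subspace0 Z_subspace; have := coef_lin 1 k Z0 Z0.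
by rewrite scaler0 addr0 mul1r => h; lra.
Qed.

Let coefZ c x k : Z x -> coef (c *: x) k = c * coef x k.
Proof.
move=> Zx; have Z0 := subspace0 Z_subspace.
by rewrite -[c *: x]addr0 coef_lin// coef0 addr0.
Qed.

(** The second part of the norm of x, at the level m. *)
Let phi x m := W m * \sum_(k < m) `|coef x k|.

Let phi_ge0 x m : 0 <= phi x m.
Proof. by rewrite mulr_ge0// sumr_ge0. Qed.

Let phi_le x m : Z x -> phi x m <= K * `|x|.
Proof. by move=> Zx; exact: expands_l1 (coefP Zx). Qed.

(** For finitely many nonzero coefficients this is the convergence of W to 0, and phi
    is continuous in x uniformly in m. *)
Let phi_cvg0 x : Z x -> phi x m @[m --> \oo] --> (0 : R).
Proof.
move=> Zx; apply/(@seq_cvgP R R^o) => eps eps0.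
have K20 : 0 < 2 * K by rewrite mulr_gt0.
have [N hN] := iffLR (seq_cvgP _ _) (coefP Zx) _ (divr_gt0 eps0 K20).
pose c k := if (k < N)%N then coef x k else 0.
have ec : expands (psum N (coef x)) c.
  apply: cvg_near_cst; exists N => // n /= Nn.
  rewrite /psum -(sum_truncate (fun k => coef x k *: e k) Nn).
  by apply: eq_bigr => k _; rewrite /c; case: ifP => //; rewrite scale0r.
pose L := \sum_(k < N) `|coef x k|.
have L0 : 0 < L + 1 by rewrite ltr_wpDl// sumr_ge0.
have e2 : 0 < eps / 2 by rewrite divr_gt0.
have [M hM] := iffLR (@seq_cvgP R R^o _ _) W_cvg0 _ (divr_gt0 e2 L0).
exists (maxn N M) => m; rewrite geq_max => /andP[Nm Mm].
rewrite subr0 ger0_norm//.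
apply: (@le_trans _ _ (W m * \sum_(k < m) `|coef x k - c k| + W m * \sum_(k < m) `|c k|)).
  rewrite -mulrDr ler_wpM2l// -big_split/=; apply: ler_sum => k _.
  by rewrite -[X in `|X| <= _](subrK (c k)); exact: ler_normD.
have h1 := expands_l1 m (expands_sub (coefP Zx) ec).
have h2 : K * `|x - psum N (coef x)| <= eps / 2.
  have := hN _ (leqnn N); rewrite distrC ler_pdivlMr// mulrC; lra.
have -> : \sum_(k < m) `|c k| = L.
  rewrite /L -(sum_truncate (fun k => `|coef x k|) Nm); apply: eq_bigr => k _.
  by rewrite /c; case: ifP => //; rewrite normr0.
have := hM _ Mm; rewrite subr0 ger0_norm// ler_pdivlMr// => h3.
have : W m * L <= W m * (L + 1) by rewrite ler_wpM2l// lerDl.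
lra.
Qed.

Let small_coef_le x eps k : 0 < eps -> (forall n, \sum_(k < n) coef x k ^+ 2 <= eps ^+ 2) ->
  `|coef x k| <= eps.
Proof.
move=> eps0 h; apply: ler_of_sqr; first exact: ltW.
rewrite real_normK ?num_real//; apply: le_trans (h k.+1).
by rewrite big_ord_recr/= lerDr; apply: sumr_ge0 => i _; exact: sqr_ge0.
Qed.

(** From here on the l_2 norm of the coefficients does not control the norm on X. *)
Context (not_l2 : forall c, exists2 x, X x & c * dot x x < `|x| ^+ 2).

Let unit_small_l2 eps : 0 < eps -> exists x, [/\ X x, `|x| = 1
  & forall n, \sum_(k < n) coef x k ^+ 2 <= eps ^+ 2].
Proof.
move=> eps0; have [x Xx hx] := not_l2 (eps ^- 2).
have Zx := XZ Xx.
have d0 : 0 <= dot x x by have := dot_partial 0 Zx; rewrite big_ord0.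
have e20 : 0 < eps ^+ 2 by rewrite exprn_gt0.
have x0 : 0 < `|x|.
  rewrite lt_neqAle normr_ge0 andbT eq_sym; apply: contraTneq hx => ->.
  by rewrite expr0n/= -leNgt mulr_ge0// invr_ge0 ltW.
exists (`|x|^-1 *: x); split.
- exact: subspaceZ.
- by rewrite normrZ normfV normr_id mulVf// gt_eqF.
- move=> n; under eq_bigr do rewrite coefZ// exprMn.
  rewrite -mulr_sumr exprVn mulrC ler_pdivrMr ?exprn_gt0//.
  apply: (le_trans (dot_partial n Zx)); move: hx.
  by rewrite mulrC ltr_pdivrMr// mulrC => /ltW.
Qed.

(** A unit vector x of X with tiny l_2 part: phi x is small up to N because finitely
    many coefficients are involved, it is small near infinity by phi_cvg0, and it must
    be large at some m in between, since otherwise both parts of the norm would be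
    small. The triple t consists of x, of m and of the end of the window around m. *)
Let hump N d : 0 < d -> d < (2 * K)^-1 -> exists t : E * nat * nat,
  [/\ X t.1.1, `|t.1.1| = 1, forall n, \sum_(k < n) coef t.1.1 k ^+ 2 <= d ^+ 2
    & forall j, (j <= N)%N -> phi t.1.1 j <= d] /\
  [/\ (N < t.1.2)%N, (t.1.2 < t.2)%N, forall j, (t.2 <= j)%N -> phi t.1.1 j <= d
    & (2 * K)^-1 <= phi t.1.1 t.1.2].
Proof.
move=> d0 dK.
pose b := \sum_(m < N.+1) W m * m%:R.
have b0 : 0 <= b by apply: sumr_ge0 => i _; rewrite mulr_ge0.
have b1 : 0 < b + 1 by rewrite ltr_wpDl.
have db : 0 < d / (b + 1) by rewrite divr_gt0.
have dbd : d / (b + 1) <= d by rewrite ler_pdivrMr// ler_peMr ?lerDr// ltW.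
have [x [Xx nx hx]] := unit_small_l2 db.
have Zx := XZ Xx.
have small n : \sum_(k < n) coef x k ^+ 2 <= d ^+ 2.
  by apply: (le_trans (hx n)); apply: lerXn2r; rewrite ?nnegrE// ltW.
have init j : (j <= N)%N -> phi x j <= d.
  move=> jN; rewrite /phi.
  apply: (@le_trans _ _ (W j * (j%:R * (d / (b + 1))))).
    rewrite ler_wpM2l//.
    have -> : j%:R * (d / (b + 1)) = \sum_(k < j) (d / (b + 1)).
      by rewrite sumr_const card_ord mulr_natl.
    by apply: ler_sum => k _; exact: small_coef_le.
  have -> : W j * (j%:R * (d / (b + 1))) = d * (W j * j%:R) / (b + 1) by ring.
  rewrite ler_pdivrMr// ler_wpM2l//; first exact: ltW.
  apply: (@le_trans _ _ b); last by rewrite lerDl.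
  have jN1 : (j < N.+1)%N by [].
  rewrite /b (bigD1 (Ordinal jN1))//= lerDl; apply: sumr_ge0 => i _.
  by rewrite mulr_ge0.
have [m hm] : exists m, (2 * K)^-1 <= phi x m.
  apply: contrapT => nm.
  have K20 : 0 < (2 * K)^-1 by rewrite invr_gt0 mulr_gt0.
  have := @expands_norm_le x _ _ (coefP Zx) K20.
  rewrite nx => h; have {h}: 1 <= K * (2 * K)^-1.
    apply: h => [n|m].
      apply: (le_trans (small n)).
      by apply: lerXn2r; rewrite ?nnegrE ?(ltW d0) ?(ltW K20)// ltW.
    by apply: ltW; rewrite ltNge; apply/negP => h; apply: nm; exists m.
  have -> : K * (2 * K)^-1 = 2^-1 by field; rewrite gt_eqF.
  by move=> h; have : (1 : R) <= 2^-1 := h; lra.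
have [M hM] := iffLR (@seq_cvgP R R^o _ _) (phi_cvg0 Zx) _ d0.
have Nm : (N < m)%N.
  by rewrite ltnNge; apply/negP => /init; rewrite leNgt (lt_le_trans dK hm).
exists (x, m, maxn M m.+1); split; split => //=; first by rewrite leq_maxr.
move=> j; rewrite geq_max => /andP[Mj _]; have := hM j Mj.
by rewrite subr0 ger0_norm.
Qed.

(** The sum of the d i is at most 1 / (4 K), which makes the Gram matrix of the
    functionals g i and the vectors x_ j differ from the identity by at most 1 / 2. *)
Let d i : R := (8 * K)^-1 / 2 ^+ i.

Let d_gt0 i : 0 < d i.
Proof. by rewrite divr_gt0 ?exprn_gt0// invr_gt0 mulr_gt0. Qed.

Let d_lt i : d i < (2 * K)^-1.
Proof.
apply: (@le_lt_trans _ _ (8 * K)^-1).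
  by rewrite /d ler_pdivrMr ?exprn_gt0// ler_peMr ?exprn_ege1 ?ler1n// invr_ge0 mulr_ge0.
by rewrite ltf_pV2 ?posrE ?mulr_gt0// ltr_pM2r// ltr_nat.
Qed.

Let sum_d n : \sum_(i < n) d i <= (4 * K)^-1.
Proof.
have Kn0 : K != 0 by rewrite gt_eqF.
suff -> : \sum_(i < n) d i = (4 * K)^-1 - (4 * K)^-1 / 2 ^+ n.
  by rewrite gerBl divr_ge0 ?exprn_ge0// invr_ge0 mulr_ge0.
elim: n => [|n IH]; first by rewrite big_ord0 expr0 divr1 subrr.
rewrite big_ord_recr/= IH /d exprS; field.
by rewrite expf_neq0.
Qed.

Let humpf i N := projT1 (cid (hump N (d_gt0 i) (d_lt i))).

Let seqt := fix seqt i : E * nat * nat :=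
  if i is j.+1 then humpf i (seqt j).2 else humpf 0 0%N.

Let x_ i := (seqt i).1.1.
Let m_ i := (seqt i).1.2.
Let N_ i := if i is j.+1 then (seqt j).2 else 0%N.

Let seqtP i :
  [/\ X (x_ i), `|x_ i| = 1, forall n, \sum_(k < n) coef (x_ i) k ^+ 2 <= d i ^+ 2
    & forall j, (j <= N_ i)%N -> phi (x_ i) j <= d i] /\
  [/\ (N_ i < m_ i)%N, (m_ i < N_ i.+1)%N, forall j, (N_ i.+1 <= j)%N -> phi (x_ i) j <= d i
    & (2 * K)^-1 <= phi (x_ i) (m_ i)].
Proof.
have E1 : seqt i = humpf i (N_ i) by case: i.
by rewrite /x_ /m_ /= E1 /humpf; case: cid.
Qed.

Let Xx i : X (x_ i). Proof. by have [[]] := seqtP i. Qed.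
Let Zx i : Z (x_ i). Proof. exact/XZ/Xx. Qed.
Let nx i : `|x_ i| = 1. Proof. by have [[]] := seqtP i. Qed.

Let N_lt i : (N_ i < N_ i.+1)%N.
Proof. by have [_ [h1 h2 _ _]] := seqtP i; exact: ltn_trans h2. Qed.

Let N_le i j : (i <= j)%N -> (N_ i <= N_ j)%N.
Proof.
by apply: (homo_leq leqnn leq_trans) => n; exact: ltnW.
Qed.

Let m_ge i : (i <= m_ i)%N.
Proof.
have [_ [h1 _ _ _]] := seqtP i; apply: leq_trans (ltnW h1).
elim: (i) => [//|n IH]; exact: leq_ltn_trans (N_lt n).
Qed.

Let phi_outside i m : (m <= N_ i)%N \/ (N_ i.+1 <= m)%N -> phi (x_ i) m <= d i.
Proof. by have [[_ _ _ h1] [_ _ h2 _]] := seqtP i; case; [exact: h1|exact: h2]. Qed.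

(** The windows ]N_ i, N_ i.+1[ are disjoint, so m lies in at most one of them. *)
Let phi_except m : exists i0, forall i, i != i0 -> phi (x_ i) m <= d i.
Proof.
have [[i0 /andP[h1 h2]]|no] := pselect (exists i0, (N_ i0 < m < N_ i0.+1)%N).
  exists i0 => i ii0; apply: phi_outside.
  case: (ltngtP i i0) => [ii|ii|/eqP]; last by rewrite (negbTE ii0).
    by right; apply: leq_trans (ltnW h1); exact: N_le.
  by left; apply: (leq_trans (ltnW h2)); exact: N_le.
exists 0%N => i _; apply: phi_outside.
case: (leqP m (N_ i)) => [|Nm]; first by left.
case: (leqP (N_ i.+1) m) => [|mN]; first by right.
by exfalso; apply: no; exists i; rewrite Nm mN.
Qed.

Let phi_cross i j : i != j -> phi (x_ j) (m_ i) <= d j.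
Proof.
move=> ij; apply: phi_outside; have [_ [h1 h2 _ _]] := seqtP i.
case: (ltngtP i j) => [ii|ii|/eqP]; last by rewrite (negbTE ij).
  by left; apply: (leq_trans (ltnW h2)); exact: N_le.
by right; apply: leq_trans (ltnW h1); exact: N_le.
Qed.

Let sum_phi_le n m : \sum_(i < n) phi (x_ i) m <= 1 + K.
Proof.
have [i0 h0] := phi_except m.
apply: (@le_trans _ _ (\sum_(i < n) (d i + if (i == i0 :> nat) then K else 0))).
  apply: ler_sum => i _; case: eqP => [->|/eqP ii0]; last by rewrite addr0 h0.
  by apply: (le_trans (phi_le m (@Zx i0))); rewrite nx mulr1 lerDr ltW.
rewrite big_split/=; apply: lerD.
  apply: (le_trans (sum_d n)); rewrite invf_le1 ?mulr_gt0//.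
  by have := K_ge1; lra.
case: (ltnP i0 n) => [i0n|ni0].
  rewrite (bigD1 (Ordinal i0n))//= eqxx big1 ?addr0// => i /eqP ii0.
  by case: eqP => // ii; exfalso; apply: ii0; apply: val_inj.
rewrite big1// => i _; case: eqP => // ii; have := ltn_ord i.
by rewrite ii ltnNge ni0.
Qed.

Let comb n (b : nat -> R) : E := \sum_(i < n) b i *: x_ i.

Let X_comb n b : X (comb n b).
Proof. by apply: (subspace_sum sX) => i _; exact: subspaceZ. Qed.

Let coef_comb n b k : coef (comb n b) k = \sum_(i < n) b i * coef (x_ i) k.
Proof.
elim: n => [|n IH]; first by rewrite /comb !big_ord0 coef0.
rewrite /comb !big_ord_recr/= addrC coef_lin//; first by rewrite IH addrC.
exact/XZ/X_comb.
Qed.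

Let C := K * (2 + K).

(** The l_2 parts of the x_ i are summable, and at each m all the phi (x_ i) m but one
    are summably small. *)
Let comb_le n (b : nat -> R) (beta : R) : 0 < beta -> (forall i, `|b i| <= beta) ->
  `|comb n b| <= C * beta.
Proof.
move=> beta0 hb; have Zc := XZ (X_comb n b).
have M0 : 0 < (2 + K) * beta by rewrite mulr_gt0// addr_gt0.
rewrite /C -mulrA; apply: (expands_norm_le (coefP Zc) M0).
  move=> N; apply: (@le_trans _ _ ((beta * (1 + \sum_(i < n) d i)) ^+ 2)).
    elim: n {Zc} => [|n IH].
      rewrite big1; first exact: sqr_ge0.
      by move=> k _; rewrite /comb big_ord0 coef0 expr0n.
    rewrite [X in _ <= (_ * X) ^+ 2](_ : _ = 1 + \sum_(i < n) d i + d n); last first.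
      by rewrite big_ord_recr/= addrA.
    rewrite mulrDr.
    under eq_bigr => k _ do rewrite coef_comb big_ord_recr/= -coef_comb.
    apply: (sqsum_add_le (u := coef (comb n b)) (v := fun k => b n * coef (x_ n) k)) => //.
    - by rewrite mulr_gt0// ltr_wpDr// sumr_ge0// => i _; exact: ltW.
    - by rewrite mulr_gt0.
    - under eq_bigr do rewrite exprMn; rewrite -mulr_sumr exprMn.
      apply: ler_pM; rewrite ?sqr_ge0//; first by apply: sumr_ge0 => i _; exact: sqr_ge0.
        by rewrite -(real_normK (num_real (b n))); apply: lerXn2r; rewrite ?nnegrE// ltW.
      by have [[_ _ h _] _] := seqtP n.
  apply: lerXn2r; rewrite ?nnegrE; last 1 first.
  - rewrite mulrC ler_pM2r//.
    have : (4 * K)^-1 <= 1.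
      by rewrite invf_le1 ?mulr_gt0//; have := K_ge1; lra.
    have := sum_d n; have := K_gt0; lra.
  - by rewrite mulr_ge0 ?(ltW beta0)// addr_ge0// sumr_ge0// => i _; exact: ltW.
  - exact: ltW.
move=> m; apply: (@le_trans _ _ (\sum_(i < n) beta * phi (x_ i) m)).
  rewrite mulr_sumr.
  apply: (@le_trans _ _ (\sum_(k < m) \sum_(i < n) W m * (beta * `|coef (x_ i) k|))).
    apply: ler_sum => k _; rewrite -mulr_sumr ler_wpM2l// coef_comb.
    apply: (le_trans (ler_norm_sum _ _ _)); apply: ler_sum => i _.
    by rewrite normrM ler_wpM2r.
  rewrite exchange_big/=; apply: ler_sum => i _.
  by rewrite /phi mulrCA mulr_sumr mulr_sumr.
rewrite -mulr_sumr mulrC ler_pM2r//; apply: (le_trans (sum_phi_le n m)); lra.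
Qed.

Let C_gt0 : 0 < C.
Proof. by rewrite mulr_gt0// addr_gt0. Qed.

Let comb_sub m n b : (m <= n)%N ->
  comb n b - comb m b = comb n (fun i => if (i < m)%N then 0 else b i).
Proof.
move=> mn; rewrite /comb -(sum_truncate (fun i => b i *: x_ i) mn) -sumrB.
by apply: eq_bigr => i _; case: ifP => _; rewrite ?subrr ?scale0r// subr0.
Qed.

Let series_cvg (b : c0 R) : exists y : E, comb n b @[n --> \oo] --> y.
Proof.
apply: cE => eps eps0; have ec : 0 < eps / C by rewrite divr_gt0.
have [N hN] := iffLR (@seq_cvgP R R^o _ _) (c0_cvg b) _ ec.
have main m n : (N <= m)%N -> (m <= n)%N -> `|comb n b - comb m b| <= eps.
  move=> Nm mn; rewrite comb_sub//.
  have -> : eps = C * (eps / C) by field; rewrite gt_eqF.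
  apply: comb_le => // i; case: ltnP => [_|mi]; first by rewrite normr0 ltW.
  by have := hN i (leq_trans Nm mi); rewrite subr0.
exists N => m n Nm Nn; case: (leqP m n) => [mn|/ltnW nm].
  by rewrite distrC; exact: main.
exact: main.
Qed.

Let T0 b := projT1 (cid (series_cvg b)).

Let T0P (b : c0 R) : comb n b @[n --> \oo] --> T0 b.
Proof. by rewrite /T0; case: cid. Qed.

Let X_T0 b : X (T0 b).
Proof. by apply: (closed_seq clX (@T0P b)) => n; exact: X_comb. Qed.

Let T0_lin (c : R) (a b : c0 R) : T0 (c *: a + b) = c *: T0 a + T0 b.
Proof.
apply: (seq_cvg_unique (@T0P _)).
have -> : (fun n => comb n (c *: a + b : c0 R)) = (fun n => c *: comb n a + comb n b).
  apply/funext => n; rewrite /comb scaler_sumr -big_split/=; apply: eq_bigr => i _.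
  by rewrite -[LHS]/((c * a i + b i) *: x_ i) scalerDl scalerA.
exact: cvgD (cvgZl_tmp (@T0P a)) (@T0P b).
Qed.

Let T0_le (b : c0 R) : `|T0 b| <= C * `|b|.
Proof.
apply/ler_addgt0Pr => eps eps0; apply: (seq_cvg_norm_le (@T0P b)); apply: nearW => n.
have ec : 0 < eps / C by rewrite divr_gt0.
have -> : C * `|b| + eps = C * (`|b| + eps / C) by field; rewrite gt_eqF.
apply: comb_le; first by rewrite ltr_wpDl.
by move=> i; apply: (le_trans (c0_coord_le b i)); rewrite lerDl ltW.
Qed.

(** The functional norming x_ i at the level m_ i, scaled so that g i (x_ i) = 1. *)
Let g i y := (phi (x_ i) (m_ i))^-1 *
  (W (m_ i) * \sum_(k < m_ i) Num.sg (coef (x_ i) k) * coef y k).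

Let phi_diag i : (2 * K)^-1 <= phi (x_ i) (m_ i).
Proof. by have [_ []] := seqtP i. Qed.

Let phi_diag_gt0 i : 0 < phi (x_ i) (m_ i).
Proof. by apply: lt_le_trans (phi_diag i); rewrite invr_gt0 mulr_gt0. Qed.

Let g_self i : g i (x_ i) = 1.
Proof.
rewrite /g; under eq_bigr do rewrite -normrEsg.
by rewrite -/(phi (x_ i) (m_ i)) mulVf// gt_eqF.
Qed.

Let g_lin i c y z : Z y -> Z z -> g i (c *: y + z) = c * g i y + g i z.
Proof.
move=> Zy Zz; rewrite /g; under eq_bigr do rewrite coef_lin// mulrDr mulrCA.
by rewrite big_split/= -mulr_sumr; ring.
Qed.

Let g_le i y : `|g i y| <= 2 * K * phi y (m_ i).
Proof.
rewrite /g normrM normfV (gtr0_norm (phi_diag_gt0 i)); apply: ler_pM => //.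
- by rewrite invr_ge0 ltW.
- by rewrite -[leRHS]invrK lef_pV2 ?posrE// invr_gt0 mulr_gt0.
rewrite normrM (ger0_norm (W_ge0 _)) ler_wpM2l//.
apply: (le_trans (ler_norm_sum _ _ _)); apply: ler_sum => k _.
by rewrite normrM ler_piMl// normr_sg lern1 leq_b1.
Qed.

Let g_norm_le i y : Z y -> `|g i y| <= 2 * K * K * `|y|.
Proof.
move=> Zy; apply: (le_trans (g_le _ _)); rewrite -[leRHS]mulrA ler_wpM2l ?mulr_ge0//.
exact: phi_le.
Qed.

Let g_cvg0 y : Z y -> g i y @[i --> \oo] --> (0 : R).
Proof.
move=> Zy; apply/(@seq_cvgP R R^o) => eps eps0.
have K20 : 0 < 2 * K by rewrite mulr_gt0.
have [N hN] := iffLR (@seq_cvgP R R^o _ _) (phi_cvg0 Zy) _ (divr_gt0 eps0 K20).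
exists N => i Ni; rewrite subr0; apply: (le_trans (g_le _ _)).
have := hN _ (leq_trans Ni (m_ge i)); rewrite subr0 ger0_norm//.
by rewrite ler_pdivlMr// mulrC.
Qed.

Let G_exists y : exists c : c0 R, Z y -> forall i, c i = g i y.
Proof.
have [Zy|nZy] := pselect (Z y); last by exists 0.
by exists (mk_c0 (g_cvg0 Zy)).
Qed.

Let G y := projT1 (cid (G_exists y)).

Let GE y : Z y -> forall i, G y i = g i y.
Proof. by rewrite /G; case: cid. Qed.

Let G_lin c y z : Z y -> Z z -> G (c *: y + z) = c *: G y + G z.
Proof.
move=> Zy Zz; apply: c0_ext => i; rewrite GE; last exact: (subspaceP c Z_subspace Zy Zz).
by rewrite g_lin// -[RHS]/(c * G y i + G z i) !GE.
Qed.

Let G_le y : Z y -> `|G y| <= 2 * K * K * `|y|.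
Proof. by move=> Zy; apply: c0_norm_leP => i; rewrite GE//; exact: g_norm_le. Qed.

Let g_comb i n b : g i (comb n b) = \sum_(j < n) b j * g i (x_ j).
Proof.
elim: n => [|n IH].
  rewrite /comb !big_ord0 /g big1 ?mulr0// => k _; by rewrite coef0 mulr0.
rewrite /comb !big_ord_recr/= addrC g_lin//; first by rewrite IH addrC.
exact/XZ/X_comb.
Qed.

Let g_cross i j : i != j -> `|g i (x_ j)| <= 2 * K * d j.
Proof.
move=> ij; apply: (le_trans (g_le _ _)); rewrite ler_wpM2l ?mulr_ge0//.
exact: phi_cross.
Qed.

(** The off-diagonal entries g i (x_ j) are at most 2 K d j, and the sum of these
    bounds is at most 1 / 2. *)
Let GT_near_id (b : c0 R) : `|G (T0 b) - b| <= `|b| / 2.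
Proof.
apply: c0_norm_leP => i; rewrite c0_subE GE; last exact/XZ/X_T0.
have gc : g i (comb n b) - b i @[n --> \oo] --> g i (T0 b) - b i.
  apply: cvgB; last exact: cvg_cst.
  apply/(@seq_cvgP R R^o) => eps eps0.
  have D0 : 0 < 2 * K * K by rewrite !mulr_gt0.
  have [N hN] := iffLR (seq_cvgP _ _) (@T0P b) _ (divr_gt0 eps0 D0).
  exists N => n Nn; have Zc := XZ (X_comb n b); have ZT := XZ (X_T0 b).
  have -> : g i (comb n b) - g i (T0 b) = g i (comb n b - T0 b).
    by rewrite [comb n b - _]addrC -(scaleN1r (T0 b)) g_lin// mulN1r addrC.
  apply: (le_trans (g_norm_le _ (subspaceB Z_subspace Zc ZT))).
  by have := hN n Nn; rewrite ler_pdivlMr// mulrC.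
apply: (@seq_cvg_norm_le _ R^o _ _ _ gc); exists i.+1 => // n /= iltn.
rewrite g_comb (bigD1 (Ordinal iltn))//= g_self mulr1 addrAC subrr add0r.
apply: (le_trans (ler_norm_sum _ _ _)).
apply: (@le_trans _ _ (\sum_(j < n) `|b| * (2 * K * d j))).
  rewrite [leRHS](bigD1 (Ordinal iltn))//=; apply: ler_wpDl.
    by apply: mulr_ge0 => //; apply: mulr_ge0; [exact: mulr_ge0|exact: ltW].
  apply: ler_sum => j ji; rewrite normrM; apply: ler_pM => //; first exact: c0_coord_le.
  by apply: g_cross; rewrite eq_sym; exact: ji.
rewrite -mulr_sumr ler_wpM2l// -mulr_sumr.
apply: (@le_trans _ _ (2 * K * (4 * K)^-1)); first by rewrite ler_wpM2l ?mulr_ge0.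
have -> : 2 * K * (4 * K)^-1 = 2^-1 by field; rewrite gt_eqF.
by [].
Qed.

(** T0 embeds c_0 into X and G maps Z to c_0. As G T0 is invertible, T0 (G T0)^-1 G is
    a projection onto the range of T0, and (G T0)^-1 G inverts T0. *)
Lemma complemented_c0_of_not_l2_equivalent : exists Y : set E,
  [/\ Y `<=` X, linear_subspace Y, closed Y, isomorphic Y (c0 R) & complemented_in Y Z].
Proof.
have [T TE] := mk_linear T0_lin.
have [A AE] : exists A : {linear c0 R -> c0 R}, forall b, A b = G (T0 b).
  by apply: mk_linear => c a b; rewrite T0_lin G_lin//; exact/XZ/X_T0.
have A_near b : `|A b - b| <= `|b| / 2 by rewrite AE; exact: GT_near_id.
have [B [AK BK B_lin B_le]] := near_identity_inverse (@seq_complete_c0 R) A_near.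
pose P y := T0 (B (G y)).
have PT b : P (T0 b) = T0 b by rewrite /P -AE AK.
have P_lin c y z : Z y -> Z z -> P (c *: y + z) = c *: P y + P z.
  by move=> Zy Zz; rewrite /P G_lin// B_lin T0_lin.
have BG_le y : Z y -> `|B (G y)| <= 4 * K * K * `|y|.
  move=> Zy; apply: (le_trans (B_le _)); have := G_le Zy; lra.
have P_le y : Z y -> `|P y| <= C * (4 * K * K) * `|y|.
  move=> Zy; apply: (le_trans (T0_le _)); rewrite -[leRHS]mulrA ler_wpM2l ?(ltW C_gt0)//.
  exact: BG_le.
have PB y z : Z y -> Z z -> P y - P z = P (y - z).
  by move=> Zy Zz; rewrite [y - z]addrC -(scaleN1r z) P_lin// scaleN1r addrC.
have BGB y z : Z y -> Z z -> B (G y) - B (G z) = B (G (y - z)).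
  by move=> Zy Zz; rewrite [y - z]addrC -(scaleN1r z) G_lin// B_lin scaleN1r addrC.
have YX : range T0 `<=` X by move=> _ [b _ <-]; exact: X_T0.
exists (range T0); split => //.
- apply: mk_subspace.
    exists 0 => //; have := T0_lin 1 0 0; rewrite !scale1r addr0 => h.
    by apply: (addrI (T0 0)); rewrite addr0 -h.
  by move=> c _ _ [a _ <-] [b _ <-]; exists (c *: a + b).
- move=> y /closure_seq [u Yu uy].
  have Xu n : X (u n) by apply: YX.
  have Zu n := XZ (Xu n); have Zy := XZ (closed_seq clX uy Xu).
  suff yP : P y = y by exists (B (G y)).
  apply/esym.
  apply: (seq_cvg_unique uy); apply/seq_cvgP => eps eps0.
  have D0 : 0 < C * (4 * K * K) by apply: (mulr_gt0 C_gt0); rewrite !mulr_gt0.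
  have [N hN] := iffLR (seq_cvgP _ _) uy _ (divr_gt0 eps0 D0); exists N => n Nn.
  have -> : u n = P (u n) by have [b _ <-] := Yu n; rewrite PT.
  rewrite PB//; apply: (le_trans (P_le _ (subspaceB Z_subspace (Zu n) Zy))).
  by have := hN n Nn; rewrite ler_pdivlMr// mulrC.
- exists T, (fun y => B (G y)); split.
  + by apply: (@linear_lipschitz_continuous _ _ _ T C) => b; rewrite TE; exact: T0_le.
  + by apply/seteqP; split=> _ [b _ <-]; exists b; rewrite ?TE.
  + by move=> b; rewrite TE -AE AK.
  + apply: (@lipschitz_within_continuous _ _ _ _ _ (4 * K * K)) => y z /YX/XZ Zy /YX/XZ Zz.
    by rewrite BGB//; exact: (BG_le _ (subspaceB Z_subspace Zy Zz)).
- split; first by move=> y /YX/XZ.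
  exists P; split => //.
  + by exists (C * (4 * K * K)).
  + by move=> y Zy; rewrite /P -AE AK.
  + apply/seteqP; split=> [_ [y Zy <-]|_ [b _ <-]]; first by exists (B (G y)).
    by exists (T0 b); [exact/XZ/X_T0|rewrite PT].
Qed.

End subspace_of_span.

Lemma l2_or_complemented_c0 (X : set E) :
  X `<=` Z -> linear_subspace X -> closed X -> ~ finite_dimensional X ->
  isomorphic X (l2 R) \/ exists Y : set E,
  [/\ Y `<=` X, linear_subspace Y, closed Y, isomorphic Y (c0 R) & complemented_in Y Z].
Proof.
move=> XZ sX clX infX.
have [[c hc]|no] := pselect (exists c, forall x, X x -> `|x| ^+ 2 <= c * dot x x).
  by left; exact: isomorphic_l2_of_l2_equivalent hc.
right; apply: (complemented_c0_of_not_l2_equivalent XZ sX clX) => c.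
apply: contrapT => nox; apply: no; exists c => x Xx.
by rewrite leNgt; apply/negP => h; apply: nox; exists x.
Qed.

End basis.

(** * Averages over random signs *)

Section sign_average.
Context (R : realType).
Implicit Types (s : seq R) (F : R -> R) (x c : R).

(** The mean of F (x + sum of e_a a) over all choices of signs e_a, for a in s. The
    recursion follows the halving of dyadic intervals. *)
Fixpoint sign_average s F x : R :=
  if s is a :: s' then (sign_average s' F (x + a) + sign_average s' F (x - a)) / 2
  else F x.

Lemma sign_average_le s F G x : (forall y, F y <= G y) ->
  sign_average s F x <= sign_average s G x.
Proof.
move=> FG; elim: s x => [|a s IH] x //=.
by rewrite ler_pM2r ?invr_gt0// lerD.
Qed.

Lemma sign_average_ge0 s F x : (forall y, 0 <= F y) -> 0 <= sign_average s F x.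
Proof.
move=> F0; elim: s x => [|a s IH] x //=.
by rewrite divr_ge0// addr_ge0.
Qed.

Lemma sign_averageD s F G x :
  sign_average s (fun y => F y + G y) x = sign_average s F x + sign_average s G x.
Proof. by elim: s x => [|a s IH] x //=; rewrite !IH; field. Qed.

Lemma sign_averageZ s k F x :
  sign_average s (fun y => k * F y) x = k * sign_average s F x.
Proof. by elim: s x => [|a s IH] x //=; rewrite !IH; field. Qed.

Lemma sign_average_sqr s x :
  sign_average s (fun y => y ^+ 2) x = x ^+ 2 + \sum_(a <- s) a ^+ 2.
Proof.
elim: s x => [|a s IH] x /=; first by rewrite big_nil addr0.
by rewrite !IH big_cons; field.
Qed.

Lemma sign_average_pow4 s x :
  sign_average s (fun y => y ^+ 4) x <=
  x ^+ 4 + 6 * x ^+ 2 * (\sum_(a <- s) a ^+ 2) + 3 * (\sum_(a <- s) a ^+ 2) ^+ 2.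
Proof.
elim: s x => [|a s IH] x /=; first by rewrite big_nil mulr0 expr0n/= mulr0 !addr0.
rewrite ler_pdivrMr//; apply: (le_trans (lerD (IH _) (IH _))); rewrite big_cons.
set t := \sum_(_ <- _) _; rewrite -subr_ge0.
set D := (X in 0 <= X); have -> : D = 4 * a ^+ 4 by rewrite /D; ring.
by rewrite mulr_ge0// -[4%N]/(2 * 2)%N exprM sqr_ge0.
Qed.

(** Khinchine's lower bound for the first moment: integrate the pointwise inequality
    4 y^2 - y^4 <= 4 |y|, rescaled by t, and use the second and fourth moments. *)
Lemma sign_average_abs_ge s (t : R) : 0 <= t -> \sum_(a <- s) a ^+ 2 = t ^+ 2 ->
  t / 4 <= sign_average s Num.norm 0.
Proof.
rewrite le_eqVlt => /orP[/eqP<- _|t0 st]; first by rewrite mul0r sign_average_ge0.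
have pt y : 4 * t ^+ 2 * y ^+ 2 + (-1) * y ^+ 4 <= 4 * t ^+ 3 * `|y|.
  have -> : y ^+ 4 = (y ^+ 2) ^+ 2 by rewrite -exprM.
  rewrite -(real_normK (num_real y)); have := normr_ge0 y; set z := `|y| => z0.
  (* 6/5 approximates 2/sqrt 3, where the cubic is minimal *)
  have cubic : 0 <= z ^+ 3 - 4 * t ^+ 2 * z + 4 * t ^+ 3.
    have -> : z ^+ 3 - 4 * t ^+ 2 * z + 4 * t ^+ 3 = (z - 6 / 5 * t) ^+ 2 * (z + 12 / 5 * t)
      + 8 / 25 * t ^+ 2 * z + 68 / 125 * t ^+ 3 by field.
    have t00 := ltW t0.
    have h1 : 0 <= z + 12 / 5 * t by lra.
    have h2 := mulr_ge0 (sqr_ge0 (z - 6 / 5 * t)) h1.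
    have h3 := mulr_ge0 (sqr_ge0 t) z0; have h4 := exprn_ge0 3 t00; lra.
  have -> : 4 * t ^+ 3 * z = 4 * t ^+ 2 * z ^+ 2 + -1 * (z ^+ 2) ^+ 2 +
    z * (z ^+ 3 - 4 * t ^+ 2 * z + 4 * t ^+ 3) by ring.
  by rewrite lerDl mulr_ge0.
have := sign_average_le s 0 pt; rewrite sign_averageD !sign_averageZ sign_average_sqr st.
have := sign_average_pow4 s 0; rewrite st !expr0n/= mulr0 mul0r !add0r => h4 h.
rewrite ler_pdivrMr// -(ler_pM2l (exprn_gt0 3 t0)).
set A := sign_average s Num.norm 0 in h *.
have -> : t ^+ 3 * t = 4 * t ^+ 2 * t ^+ 2 - 3 * (t ^+ 2) ^+ 2 by ring.
have -> : t ^+ 3 * (A * 4) = 4 * t ^+ 3 * A by ring.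
lra.
Qed.

Lemma sign_average_norm_ge s x : `|x| <= sign_average s Num.norm x.
Proof.
elim: s x => [|a s IH] x //=; rewrite ler_pdivlMr//.
apply: le_trans (lerD (IH _) (IH _)); apply: le_trans (ler_normD _ _).
have -> : x + a + (x - a) = x *+ 2 by ring.
by rewrite normrMn mulr_natr.
Qed.

Lemma powR_midpoint (p x y : R) : 1 <= p -> 0 <= x -> 0 <= y ->
  ((x + y) / 2) `^ p <= (x `^ p + y `^ p) / 2.
Proof.
move=> p1 x0 y0.
have h2 : 2^-1 = 1 - 2^-1 :> R by field.
rewrite !mulrDl ![_ / 2]mulrC {2 4}h2.
by apply: (convex_powR p1 (Itv01 _ _)) => //=;
  rewrite ?inE/= ?in_itv/= ?x0 ?y0// ?invr_ge0// invf_le1 ?ler1n.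
Qed.

Lemma sign_average_jensen (p : R) s F x : 1 <= p -> (forall y, 0 <= F y) ->
  (sign_average s F x) `^ p <= sign_average s (fun y => F y `^ p) x.
Proof.
move=> p1 F0; elim: s x => [|a s IH] x //=.
apply: (le_trans (powR_midpoint p1 _ _)); rewrite ?sign_average_ge0//.
by rewrite ler_pM2r ?invr_gt0// lerD.
Qed.

(** A crude form of cosh u <= exp (u^2 / 2), enough for sub-Gaussian moments. *)
Lemma cosh_le (u : R) : (expR u + expR (- u)) / 2 <= expR (2 * u ^+ 2).
Proof.
wlog u0 : u / 0 <= u.
  move=> h; have [/h//|/ltW u0] := lerP 0 u.
  by have := h (- u); rewrite sqrrN opprK oppr_ge0 u0 addrC; exact.
have e4 : expR 1 <= 4 :> R.
  have h : expR (- 2^-1) >= 2^-1 :> R by have := expR_ge1Dx (- 2^-1 : R); lra.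
  have h2 : expR (2^-1) <= 2 :> R.
    have := expRxMexpNx_1 (2^-1 : R); have := expR_ge0 (2^-1 : R).
    by move: h; set a := expR (- _); set b := expR _ => h b0 ba; nra.
  have -> : 1 = 2^-1 + 2^-1 :> R by field.
  rewrite expRD; have := expR_ge0 (2^-1 : R); nra.
have [u1|u1] := lerP u 1; last first.
  apply: (@le_trans _ _ (expR u)).
    rewrite ler_pdivrMr//; have : expR (- u) <= expR u by rewrite ler_expR; lra.
    lra.
  by rewrite ler_expR; nra.
apply: le_trans (expR_ge1Dx _).
(* e^u + e^-u - 2 is the square of e^v - e^-v <= 2 v e^v, where v = u / 2 *)
pose v := u / 2; have v0 : 0 <= v by rewrite divr_ge0.
have euv : expR u = expR v ^+ 2 by rewrite expr2 -expRD /v; congr expR; field.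
have enuv : expR (- u) = expR (- v) ^+ 2 by rewrite expr2 -expRD /v; congr expR; field.
have vv : expR v * expR (- v) = 1 by rewrite -expRD subrr expR0.
have up : expR v - expR (- v) <= 2 * v * expR v.
  have := expR_ge1Dx (- (2 * v)).
  have -> : expR (- (2 * v)) = expR (- v) * expR (- v) by rewrite -expRD; congr expR; ring.
  have := expR_gt0 v; set a := expR v in vv *; set b := expR (- v) in vv * => a0 h.
  have : a * (1 - 2 * v) <= a * (b * b) by rewrite ler_pM2l.
  rewrite mulrA vv mul1r; lra.
have low : 0 <= expR v - expR (- v) by rewrite subr_ge0 ler_expR; lra.
have sq : (expR v - expR (- v)) ^+ 2 <= (2 * v * expR v) ^+ 2.
  by apply: lerXn2r; rewrite ?nnegrE// (le_trans low).
have e4u : expR v ^+ 2 <= 4 by rewrite -euv (le_trans _ e4)// ler_expR.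
rewrite euv enuv ler_pdivrMr//.
move: sq; rewrite sqrrB vv exprMn.
have -> : (2 * v) ^+ 2 = u ^+ 2 by rewrite /v; field.
have := sqr_ge0 u; move: e4u; set A := expR v ^+ 2; set B := expR (- v) ^+ 2.
by set w := u ^+ 2; nra.
Qed.

Lemma sign_average_expR (l : R) s x : sign_average s (fun y => expR (l * y)) x <=
  expR (l * x + 2 * l ^+ 2 * \sum_(a <- s) a ^+ 2).
Proof.
elim: s x => [|a s IH] x /=; first by rewrite big_nil mulr0 addr0.
rewrite big_cons; set t := \sum_(_ <- _) _ in IH *.
have -> : l * x + 2 * l ^+ 2 * (a ^+ 2 + t) = (l * x + 2 * l ^+ 2 * t) + 2 * (l * a) ^+ 2 by ring.
rewrite expRD; apply: (@le_trans _ _ (expR (l * x + 2 * l ^+ 2 * t) *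
  ((expR (l * a) + expR (- (l * a))) / 2))); last first.
  by rewrite ler_wpM2l ?expR_ge0// cosh_le.
rewrite mulrA ler_pM2r ?invr_gt0// mulrDr -!expRD.
apply: lerD; apply: (le_trans (IH _)); rewrite ler_expR; lra.
Qed.

Lemma powR_le_expR (p y : R) : 1 <= p -> 0 <= y -> y `^ p <= p `^ p * expR y.
Proof.
move=> p1 y0; have p0 : 0 < p by exact: lt_le_trans p1.
have -> : expR y = expR (y / p) `^ p by rewrite -expRM divfK// gt_eqF.
rewrite -powRM ?expR_ge0 ?(ltW p0)//.
apply: ge0_ler_powR; rewrite ?nnegrE ?mulr_ge0 ?expR_ge0 ?(ltW p0)//.
rewrite mulrC -ler_pdivrMr//; have := expR_ge1Dx (y / p); lra.
Qed.

(** The p-th power of a constant in Khinchine's upper bound: p^p comes from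
    y^p <= p^p e^y, and 2 e^3 bounds the exponential moments. *)
Definition moment_bound (p : R) : R := 2 * p `^ p * expR 3.

Lemma moment_bound_ge1 (p : R) : 1 <= p -> 1 <= moment_bound p.
Proof.
move=> p1; have h1 : 1 <= p `^ p by apply: (le_trans p1); exact: le1r_powR.
have h2 : 1 <= expR 3 :> R by have := expR_ge1Dx (3 : R); lra.
rewrite /moment_bound; nra.
Qed.

(** Khinchine's upper bound, with a constant term x allowed: by homogeneity the
    exponential moments need only be controlled at the scale h. *)
Lemma sign_average_powR_le (p h : R) s x : 1 <= p -> 0 < h -> `|x| <= h ->
  \sum_(a <- s) a ^+ 2 <= h ^+ 2 ->
  sign_average s (fun y => `|y| `^ p) x <= moment_bound p * h `^ p.
Proof.
move=> p1 h0 xh sh; have p0 : 0 < p by exact: lt_le_trans p1.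
have pt y : `|y| `^ p <= (h `^ p * p `^ p) * (expR (h^-1 * y) + expR (- h^-1 * y)).
  have -> : `|y| = h * `|h^-1 * y|.
    by rewrite normrM gtr0_norm ?invr_gt0// mulrA mulfV ?mul1r// gt_eqF.
  rewrite powRM ?(ltW h0)// -mulrA ler_wpM2l ?powR_ge0//.
  apply: (le_trans (powR_le_expR p1 (normr_ge0 _))); rewrite ler_wpM2l ?powR_ge0//.
  by rewrite mulNr; case: ger0P => _; rewrite ?lerDl ?lerDr expR_ge0.
apply: (le_trans (sign_average_le s x pt)); rewrite sign_averageZ sign_averageD.
have e3 l : `|l| = h^-1 -> sign_average s (fun y => expR (l * y)) x <= expR 3.
  move=> lh; apply: (le_trans (sign_average_expR _ _ _)); rewrite ler_expR.
  have h1 : l * x <= 1.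
    by rewrite (le_trans (ler_norm _))// normrM lh mulrC ler_pdivrMr// mul1r.
  have h2 : l ^+ 2 * \sum_(a <- s) a ^+ 2 <= 1.
    rewrite -(real_normK (num_real l)) lh exprVn mulrC ler_pdivrMr ?exprn_gt0//.
    by rewrite mul1r.
  lra.
have n1 : `|h^-1| = h^-1 by rewrite gtr0_norm ?invr_gt0.
have n2 : `|- h^-1| = h^-1 by rewrite normrN.
have := lerD (e3 _ n1) (e3 _ n2); set A := _ + _ => hA.
have -> : moment_bound p * h `^ p = h `^ p * p `^ p * (expR 3 + expR 3).
  by rewrite /moment_bound; ring.
by rewrite ler_wpM2l// mulr_ge0 ?powR_ge0.
Qed.

(** Random signs after the constant x cannot decrease the p-th mean (Jensen). *)
Lemma sign_average_powR_ge_norm (p : R) s x : 1 <= p ->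
  `|x| `^ p <= sign_average s (fun y => `|y| `^ p) x.
Proof.
move=> p1; apply: le_trans (sign_average_jensen s x p1 _) => //.
apply: ge0_ler_powR; rewrite ?nnegrE ?sign_average_ge0 ?(le_trans _ p1)//.
exact: sign_average_norm_ge.
Qed.

Lemma sign_average_powR_ge_l2 (p t : R) s : 1 <= p -> 0 <= t ->
  \sum_(a <- s) a ^+ 2 = t ^+ 2 ->
  (t / 4) `^ p <= sign_average s (fun y => `|y| `^ p) 0.
Proof.
move=> p1 t0 st; apply: le_trans (sign_average_jensen s 0 p1 _) => //.
apply: ge0_ler_powR; rewrite ?nnegrE ?sign_average_ge0 ?divr_ge0 ?(le_trans _ p1)//.
exact: sign_average_abs_ge.
Qed.

End sign_average.

(** * Rademacher sums on dyadic intervals *)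

Section dyadic.
Context (R : realType).
Local Notation mu := (@lebesgue_measure R).
Local Notation rad := (@rademacher R).

(** Open, so that the Rademacher functions up to level m do not vanish on it. *)
Definition dyadic m j : set R := `](j%:R / 2 ^+ m), (j.+1%:R / 2 ^+ m)[%classic.

Let pow2_gt0 m : 0 < 2 ^+ m :> R. Proof. exact: exprn_gt0. Qed.

Lemma dyadicP m j t : dyadic m j t <-> j%:R < 2 ^+ m * t < j.+1%:R.
Proof.
rewrite /dyadic /= in_itv/=; rewrite ltr_pdivrMr// ltr_pdivlMr// [t * _]mulrC.
by split.
Qed.

Lemma measurable_dyadic m j : measurable (dyadic m j).
Proof. exact: measurable_itv. Qed.

Lemma dyadic_measure m j : mu (dyadic m j) = (2 ^- m)%:E.
Proof.
rewrite /dyadic lebesgue_measure_itv/= lte_fin ltr_pM2r ?invr_gt0// ltr_nat ltnSn.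
by rewrite -EFinB -mulrBl -natrB// subSnn mul1r.
Qed.

Lemma rademacher_dyadic m j t : dyadic m j t -> rad m t = (-1) ^+ j.
Proof.
move=> /dyadicP; rewrite /rademacher.
have -> : 2 ^+ m * pi * t = pi * (2 ^+ m * t) by ring.
move: (2 ^+ m * t) => u; elim: j u => [|j IH] u /andP[ju uj].
  have pu : 0 < sin (pi * u).
    by apply: sin_gt0_pi; rewrite mulr_gt0 ?pi_gt0//= gtr_pMr ?pi_gt0.
  by rewrite gtr0_sg.
have -> : pi * u = pi * (u - 1) + pi by ring.
rewrite sinDpi sgrN IH ?exprS ?mulN1r//.
by move: ju uj; rewrite -!natr1 => ju uj; apply/andP; split; lra.
Qed.

Lemma dyadic_parent m k j : (k <= m)%N -> dyadic m j `<=` dyadic k (j %/ 2 ^ (m - k)).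
Proof.
move=> km t /dyadicP; set q := (j %/ _)%N => /andP[h1 h2]; apply/dyadicP.
set d := (m - k)%N in q *; have mE : m = (k + d)%N by rewrite /d subnKC.
have d0 : 0 < 2 ^+ d :> R by [].
have E x : 2 ^+ m * x = 2 ^+ d * (2 ^+ k * x) :> R by rewrite mE exprD; ring.
rewrite E in h1 h2.
have N0 : (0 < 2 ^ d)%N by rewrite expn_gt0.
have a1 : q%:R * 2 ^+ d <= j%:R :> R by rewrite -natrX -natrM ler_nat leq_trunc_div.
have a2 : j.+1%:R <= q.+1%:R * 2 ^+ d :> R by rewrite -natrX -natrM ler_nat ltn_ceil.
rewrite -(ltr_pM2l d0) -[X in _ && X](ltr_pM2l d0).
rewrite [2 ^+ d * q%:R]mulrC [2 ^+ d * q.+1%:R]mulrC (le_lt_trans a1 h1)/=.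
exact: lt_le_trans h2 a2.
Qed.

Definition rademacher_sum (a : nat -> R) m d (t : R) : R :=
  \sum_(k <- iota m d) a k * rad k.+1 t.

Lemma measurable_rademacher_sum a m d : measurable_fun [set: R] (rademacher_sum a m d).
Proof.
rewrite /rademacher_sum; apply: measurable_sum => k.
by apply: measurable_funM; [exact: measurable_cst|exact: measurable_rademacher].
Qed.

Lemma dyadic_split m j (g : R -> R) : measurable_fun [set: R] g -> (forall t, 0 <= g t) ->
  (\int[mu]_(t in dyadic m j) (g t)%:E =
   \int[mu]_(t in dyadic m.+1 j.*2) (g t)%:E + \int[mu]_(t in dyadic m.+1 j.*2.+1) (g t)%:E)%E.
Proof.
move=> mg g0.
have mgD (D : set R) : measurable_fun D (EFin \o g).
  by apply/measurable_EFinP; exact: measurable_funS mg.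
have -> : dyadic m j = `](j.*2%:R / 2 ^+ m.+1), (j.*2.+1%:R / 2 ^+ m.+1)[ `|`
    `[(j.*2.+1%:R / 2 ^+ m.+1), (j.*2.+2%:R / 2 ^+ m.+1)[.
  have E i : i.*2%:R / 2 ^+ m.+1 = i%:R / 2 ^+ m :> R.
    by rewrite exprS -mul2n natrM; field; rewrite gt_eqF.
  rewrite /dyadic -(E j) -(E j.+1) doubleS; apply: itv_bndbnd_setU; rewrite bnd_simp.
  - by rewrite ltr_pM2r ?invr_gt0// ltr_nat.
  - by rewrite ler_pM2r ?invr_gt0// ler_nat.
rewrite ge0_integral_setU//.
- by rewrite -integral_itv_obnd_cbnd.
- exact: mgD.
- by move=> t _; rewrite lee_fin.
- apply/disj_setPS => t [] /=; rewrite !in_itv/= => /andP[_ h1] /andP[h2 _].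
  by have := lt_le_trans h1 h2; rewrite ltxx.
Qed.

(** Halving the interval averages over the sign of the first term of the sum. *)
Lemma integral_dyadic (F : R -> R) (a : nat -> R) m d j c :
  measurable_fun [set: R] F -> (forall y, 0 <= F y) ->
  (\int[mu]_(t in dyadic m j) (F (c + rademacher_sum a m d t))%:E =
  (2 ^- m * sign_average (map a (iota m d)) F c)%:E)%E.
Proof.
move=> mF F0; elim: d m j c => [|d IH] m j c.
  under eq_integral => t _ do rewrite /rademacher_sum big_nil addr0.
  rewrite integral_cst; last exact: measurable_dyadic.
  rewrite [X in (_ * X)%E](_ : _ = (2 ^- m)%:E); last exact: dyadic_measure.
  by rewrite -EFinM mulrC.
have mFr c' m' d' : measurable_fun [set: R] (fun t => F (c' + rademacher_sum a m' d' t)).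
  apply: measurableT_comp => //; apply: measurable_funD; first exact: measurable_cst.
  exact: measurable_rademacher_sum.
rewrite dyadic_split//.
have half i e : (i = j.*2 + e)%N ->
    (\int[mu]_(t in dyadic m.+1 i) (F (c + rademacher_sum a m d.+1 t))%:E =
    (2 ^- m.+1 * sign_average (map a (iota m.+1 d)) F (c + a m * (-1) ^+ e))%:E)%E.
  move=> iE; rewrite -(IH _ i); apply: eq_integral => t; rewrite inE => ht.
  rewrite /rademacher_sum /= big_cons (rademacher_dyadic ht) iE exprD.
  by rewrite -mul2n exprM sqrrN !expr1n mul1r addrA.
rewrite (half _ 0%N) ?addn0// (half _ 1%N) ?addn1// expr0 expr1 mulr1 mulrN1.
rewrite -EFinD -mulrDr; congr EFin => /=; rewrite exprS invfM; field.
by rewrite expf_neq0.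
Qed.

(** The constant value of the sum of the first m terms on dyadic m j. *)
Definition dyadic_value (a : nat -> R) m j : R :=
  \sum_(k < m) a k * (-1) ^+ (j %/ 2 ^ (m - k.+1)).

Lemma rademacher_sum_dyadic a m n j t : (m <= n)%N -> dyadic m j t ->
  rademacher_sum a 0 n t = dyadic_value a m j + rademacher_sum a m (n - m) t.
Proof.
move=> mn mjt; rewrite /rademacher_sum -{1}(subnKC mn) iotaD big_cat/= add0n; congr (_ + _).
rewrite -[m in iota 0 m]subn0 -/(index_iota 0 m) big_mkord; apply: eq_bigr => k _.
by congr (_ * _); apply: rademacher_dyadic; apply: dyadic_parent mjt.
Qed.

Lemma dyadic_value_le a m j : `|dyadic_value a m j| <= \sum_(k < m) `|a k|.
Proof.
apply: (le_trans (ler_norm_sum _ _ _)); apply: ler_sum => k _.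
by rewrite normrM normrX normrN1 expr1n mulr1.
Qed.

(** The binary digits of j prescribe the signs of the first m Rademacher functions. *)
Lemma dyadic_value_max a m :
  exists2 j, (j < 2 ^ m)%N & dyadic_value a m j = \sum_(k < m) `|a k|.
Proof.
elim: m => [|m [j jm IH]]; first by exists 0%N => //; rewrite /dyadic_value !big_ord0.
pose e := nat_of_bool (a m < 0).
exists (j.*2 + e)%N.
  rewrite expnS mul2n; apply: (@leq_trans j.+1.*2); last by rewrite leq_double.
  by rewrite doubleS -addn2 ltn_add2l ltnS leq_b1.
rewrite /dyadic_value !big_ord_recr/= subnn expn0 divn1; congr (_ + _).
  rewrite -IH /dyadic_value; apply: eq_bigr => k _; congr (_ * _ ^+ _).
  rewrite subSn ?ltn_ord// expnS divnMA; congr (_ %/ _)%N.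
  by rewrite -muln2 divnMDl// divn_small ?addn0// ltnS leq_b1.
rewrite exprD -mul2n exprM sqrrN !expr1n mul1r /e.
have [h|h] /= := ltP (a m) 0; first by rewrite expr1 mulrN1 ltr0_norm.
by rewrite expr0 mulr1 ger0_norm.
Qed.

Lemma integral_rademacher_sum (p : R) a m n j : (m <= n)%N ->
  (\int[mu]_(t in dyadic m j) (`|rademacher_sum a 0 n t| `^ p)%:E =
  (2 ^- m * sign_average (map a (iota m (n - m))) (fun y => `|y| `^ p)
    (dyadic_value a m j))%:E)%E.
Proof.
move=> mn; rewrite -(@integral_dyadic (fun y => `|y| `^ p) a m (n - m) j).
- by apply: eq_integral => t; rewrite inE => ht; rewrite (rademacher_sum_dyadic _ mn ht).
- by apply: (measurableT_comp (measurable_powR _)); exact: normr_measurable.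
- by move=> y; exact: powR_ge0.
Qed.

End dyadic.

(** * Morrey norms of Rademacher sums *)

Section morrey_estimates.
Context (R : realType) (p : R) (w : R -> R).
Context (p1 : 1 <= p) (qw : quasi_concave w) (w1 : w 1 = 1).
Local Notation mu := (@lebesgue_measure R).
Local Notation N := (morrey_enorm p w).
Local Notation U := (`[0 : R, 1]%classic).

Let p_gt0 : 0 < p. Proof. exact: lt_le_trans p1. Qed.

Lemma subinterval_length (I : set R) : subintervals I ->
  exists l, [/\ mu I = l%:E, 0 < l & l <= 1].
Proof.
move=> [iI IU I0]; have mI : measurable I by exact: is_interval_measurable.
have muI1 : (mu I <= 1%:E)%E.
  have <- : mu U = 1%:E by rewrite lebesgue_measure_itv/= lte_fin ltr01 oppr0 adde0.
  by rewrite le_measure ?inE.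
have fI : mu I \is a fin_num by rewrite ge0_fin_numE// (le_lt_trans muI1)// ltry.
exists (fine (mu I)); rewrite fineK//; split=> //.
  by rewrite -lte_fin fineK.
by rewrite -lee_fin fineK.
Qed.

Let mean_root (l B : R) : 0 < l -> 0 <= B ->
  ((l^-1 * (l * B `^ p))%:E `^ p^-1 = B%:E)%E.
Proof.
move=> l0 B0; rewrite mulrA mulVf ?mul1r ?gt_eqF// poweR_EFin -powRrM.
by rewrite mulfV ?gt_eqF// powRr1.
Qed.

Lemma morrey_term_le (f : R -> R) (I : set R) (l B : R) : subintervals I ->
  mu I = l%:E -> 0 < l -> l <= 1 -> 0 <= B ->
  (\int[mu]_(t in I) (`|f t| `^ p)%:E <= (l * B `^ p)%:E)%E ->
  (morrey_term p w f I <= (w l * B)%:E)%E.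
Proof.
move=> sI lE l0 l1 B0 h; rewrite /morrey_term lE/= EFinM.
have wl : 0 <= w l by apply: (quasi_concave_ge0 qw); rewrite ltW.
rewrite lee_wpmul2l ?lee_fin//.
rewrite -(mean_root l0 B0).
have i0 : (0 <= \int[mu]_(t in I) (`|f t| `^ p)%:E)%E.
  by apply: integral_ge0 => t _; rewrite lee_fin powR_ge0.
apply: gt0_ler_poweR.
- by rewrite invr_ge0 ltW.
- by rewrite in_itv/= leey andbT mule_ge0// lee_fin invr_ge0 ltW.
- by rewrite in_itv/= leey andbT lee_fin !mulr_ge0 ?invr_ge0 ?powR_ge0 ?(ltW l0).
- by rewrite EFinM lee_wpmul2l// lee_fin invr_ge0 ltW.
Qed.

Lemma morrey_enorm_ge (f : R -> R) (I : set R) (l B : R) : subintervals I ->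
  mu I = l%:E -> 0 < l -> l <= 1 -> 0 <= B ->
  ((l * B `^ p)%:E <= \int[mu]_(t in I) (`|f t| `^ p)%:E)%E ->
  ((w l * B)%:E <= N f)%E.
Proof.
move=> sI lE l0 l1 B0 h; apply: (@le_trans _ _ (morrey_term p w f I)); last first.
  by rewrite unlock; apply: ereal_sup_ubound; exists I.
rewrite /morrey_term lE/= EFinM.
have wl : 0 <= w l by apply: (quasi_concave_ge0 qw); rewrite ltW.
rewrite lee_wpmul2l ?lee_fin//.
rewrite -(mean_root l0 B0).
have i0 : (0 <= \int[mu]_(t in I) (`|f t| `^ p)%:E)%E.
  by apply: integral_ge0 => t _; rewrite lee_fin powR_ge0.
apply: gt0_ler_poweR.
- by rewrite invr_ge0 ltW.
- by rewrite in_itv/= leey andbT lee_fin !mulr_ge0 ?invr_ge0 ?powR_ge0 ?(ltW l0).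
- by rewrite in_itv/= leey andbT mule_ge0// lee_fin invr_ge0 ltW.
- by rewrite EFinM lee_wpmul2l// lee_fin invr_ge0 ltW.
Qed.

Let pow2_gt0 m : 0 < 2 ^- m :> R. Proof. by rewrite invr_gt0 exprn_gt0. Qed.
Let pow2_le1 m : 2 ^- m <= 1 :> R.
Proof. by rewrite invf_le1 ?exprn_gt0// exprn_ege1// ler1n. Qed.

Lemma subintervals_dyadic m j : (j < 2 ^ m)%N -> subintervals (@dyadic R m j).
Proof.
move=> jm; split; first exact: interval_is_interval.
  move=> t /dyadicP /andP[h1 h2]; rewrite /= in_itv/=.
  have m0 : 0 < 2 ^+ m :> R by rewrite exprn_gt0.
  rewrite -(ler_pM2l m0) mulr0 -[X in _ && X](ler_pM2l m0) mulr1; apply/andP; split.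
    by apply: le_trans (ltW h1).
  by apply: (le_trans (ltW h2)); rewrite -natrX ler_nat.
by rewrite dyadic_measure lte_fin.
Qed.

(** On the dyadic interval where the first m terms all have the same sign, the other
    terms have mean zero and cannot decrease the p-th mean. *)
Lemma morrey_enorm_ge_l1 (a : nat -> R) m n : (m <= n)%N ->
  ((w (2 ^- m) * \sum_(k < m) `|a k|)%:E <= N (rademacher_sum a 0 n))%E.
Proof.
move=> mn; have [j jm jE] := dyadic_value_max a m.
apply: (morrey_enorm_ge (subintervals_dyadic jm) (dyadic_measure R m j)) => //.
  exact: sumr_ge0.
rewrite integral_rademacher_sum// lee_fin ler_pM2l// jE.
by rewrite -{1}(ger0_norm (sumr_ge0 _ _)) ?sign_average_powR_ge_norm.
Qed.

Let sum_iota (V : nmodType) (g : nat -> V) n : \sum_(k <- iota 0 n) g k = \sum_(k < n) g k.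
Proof. by rewrite -[in iota _ _](subn0 n) -/(index_iota 0 n) big_mkord. Qed.

Lemma morrey_enorm_ge_l2 (a : nat -> R) n :
  ((Num.sqrt (\sum_(k < n) a k ^+ 2) / 4)%:E <= N (rademacher_sum a 0 n))%E.
Proof.
have j0 : (0 < 2 ^ 0)%N by [].
set t := Num.sqrt _; have t0 : 0 <= t by exact: sqrtr_ge0.
have := @morrey_enorm_ge (rademacher_sum a 0 n) _ 1 (t / 4) (subintervals_dyadic j0).
rewrite w1 !mul1r; apply => //; first by rewrite dyadic_measure expr0 invr1.
  by rewrite divr_ge0.
rewrite integral_rademacher_sum// lee_fin expr0 invr1 mul1r subn0.
rewrite /dyadic_value big_ord0; apply: sign_average_powR_ge_l2 => //.
rewrite big_map sum_iota sqr_sqrtr// sumr_ge0// => i _; exact: sqr_ge0.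
Qed.

Lemma dyadic_scale (l : R) : 0 < l -> l <= 1 -> exists m, 2 ^- m.+1 < l <= 2 ^- m.
Proof.
move=> l0 l1; have ex : exists m, 2 ^- m.+1 < l.
  have c : (2^-1 : R) ^+ n @[n --> \oo] --> 0.
    by apply: cvg_expr; rewrite gtr0_norm// invf_lt1// ltr1n.
  have [M hM] := iffLR (@seq_cvgP R R^o _ _) c _ (divr_gt0 l0 (ltr0n _ 2)).
  exists M; have := hM _ (leqnSn M); rewrite subr0 ger0_norm ?exprn_ge0 ?invr_ge0// exprVn; lra.
have [m hm mmin] := ex_minnP ex; exists m; rewrite hm/=.
case: m hm mmin => [|m] hm mmin; first by rewrite expr0 invr1.
by rewrite leNgt; apply/negP => /mmin; rewrite ltnn.
Qed.

(** The closed interval is the union of two adjacent dyadic intervals of level m; it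
    may leave [0, 1], which is harmless since rademacher is defined on all of R. *)
Lemma subinterval_cover (I : set R) (l : R) m : subintervals I -> mu I = l%:E ->
  l <= 2 ^- m -> exists j, I `<=` `[(j%:R / 2 ^+ m), (j.+2%:R / 2 ^+ m)].
Proof.
move=> [iI IU I0] lE lm.
have m0 : 0 < 2 ^+ m :> R by rewrite exprn_gt0.
have Iinf : has_inf I.
  split; last by exists 0 => x /IU /=; rewrite in_itv/= => /andP[].
  by apply/set0P/eqP => I00; rewrite I00 measure0 ltxx in I0.
have a0 : 0 <= inf I.
  by apply: lb_le_inf; [case: Iinf|move=> x /IU /=; rewrite in_itv/= => /andP[]].
pose j := Num.truncn (2 ^+ m * inf I).
have /andP[j1 j2] : j%:R <= 2 ^+ m * inf I < j.+1%:R.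
  by apply: truncn_itv; rewrite mulr_ge0// ltW.
exists j => y Iy; rewrite /= in_itv/=; apply/andP; split.
  rewrite ler_pdivrMr// mulrC; apply: (le_trans j1); rewrite ler_pM2l//.
  by apply: ge_inf => //; case: Iinf.
have yx x : I x -> y - x <= l.
  move=> Ix; have [xy|yx] := leP x y; last first.
    by rewrite -lee_fin -lE (le_trans _ (measure_ge0 _ _))// lee_fin subr_le0 ltW.
  rewrite -lee_fin -lE.
  have -> : (y - x)%:E = mu `[x, y].
    rewrite lebesgue_measure_itv/= lte_fin; move: xy; rewrite le_eqVlt.
    by case/orP => [/eqP ->|->]; [rewrite ltxx subrr|rewrite EFinB].
  apply: le_measure; rewrite ?inE//; first exact: is_interval_measurable.
  by move=> z /=; rewrite in_itv/=; exact: iI.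
have : y - l <= inf I by apply: lb_le_inf; [case: Iinf|move=> x /yx; lra].
rewrite -(ler_pM2l m0) => h; rewrite ler_pdivlMr// mulrC.
have : 2 ^+ m * l <= 1 by rewrite mulrC -ler_pdivlMr// mul1r.
move: h j2; rewrite mulrBr -!natr1; lra.
Qed.

Lemma integral_adjacent_dyadic (g : R -> R) m j :
  measurable_fun [set: R] g -> (forall t, 0 <= g t) ->
  (\int[mu]_(t in `[(j%:R / 2 ^+ m)%R, (j.+2%:R / 2 ^+ m)%R]) (g t)%:E =
   \int[mu]_(t in @dyadic R m j) (g t)%:E + \int[mu]_(t in @dyadic R m j.+1) (g t)%:E)%E.
Proof.
move=> mg g0; have m0 : 0 < 2 ^+ m :> R by rewrite exprn_gt0.
have mgD (D : set R) : measurable_fun D (EFin \o g).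
  by apply/measurable_EFinP; exact: measurable_funS mg.
rewrite integral_itv_bndoo; last exact: mgD.
have -> : `](j%:R / 2 ^+ m), (j.+2%:R / 2 ^+ m)[%classic = @dyadic R m j `|`
    `[(j.+1%:R / 2 ^+ m), (j.+2%:R / 2 ^+ m)[.
  apply: itv_bndbnd_setU; rewrite bnd_simp.
  - by rewrite ltr_pM2r ?invr_gt0// ltr_nat.
  - by rewrite ler_pM2r ?invr_gt0// ler_nat.
rewrite ge0_integral_setU//.
- by rewrite -integral_itv_obnd_cbnd.
- exact: measurable_dyadic.
- exact: mgD.
- by move=> t _; rewrite lee_fin.
- apply/disj_setPS => t [] /=; rewrite !in_itv/= => /andP[_ h1] /andP[h2 _].
  by have := lt_le_trans h1 h2; rewrite ltxx.
Qed.

(** An interval of length l with 2^-(m+1) < l <= 2^-m is covered by two dyadic intervals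
    of level m, whose total length is at most 4 l. On each of them the first m terms
    contribute at most their l_1 norm, and the others at most a multiple of M. *)
Lemma morrey_enorm_le (a : nat -> R) (M : R) n : 0 < M ->
  (forall n, \sum_(k < n) a k ^+ 2 <= M ^+ 2) ->
  (forall m, w (2 ^- m) * \sum_(k < m) `|a k| <= M) ->
  (N (rademacher_sum a 0 n) <= (8 * moment_bound p * M)%:E)%E.
Proof.
move=> M0 h2 h1; rewrite unlock; apply: ge_ereal_sup => _ [I sI <-].
have [l [lE l0 l1]] := subinterval_length sI.
have [m /andP[ml lm]] := dyadic_scale l0 l1.
have [j Ij] := subinterval_cover sI lE lm.
have [_ IU _] := sI.
(* the formula for integrals over dyadic intervals of level m requires at least m
   terms, whence the padding by zeros *)
pose b k := if (k < n)%N then a k else 0.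
have bE : rademacher_sum a 0 n = rademacher_sum b 0 (maxn n m).
  apply/funext => t; rewrite /rademacher_sum -{1}(subnKC (leq_maxl n m)) iotaD big_cat/=.
  rewrite [X in _ + X]big_seq [X in _ + X]big1 ?addr0; last first.
    by move=> k; rewrite mem_iota add0n => /andP[nk _]; rewrite /b ltnNge nk mul0r.
  by rewrite !big_seq; apply: eq_bigr => k; rewrite mem_iota/= add0n /b => ->.
have b_le k : `|b k| <= `|a k| by rewrite /b; case: ifP => // _; rewrite normr0.
pose h := \sum_(k < m) `|a k| + M.
have S0 : 0 <= \sum_(k < m) `|a k| by exact: sumr_ge0.
have hp : 0 < h by rewrite ltr_wpDl.
have [B BE] : exists B, B = moment_bound p by exists (moment_bound p).
have B1 : 1 <= B by rewrite BE; exact: moment_bound_ge1.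
have B0 : 0 <= B := le_trans ler01 B1.
have h0 := ltW hp.
have piece i : (\int[mu]_(t in @dyadic R m i) (`|rademacher_sum b 0 (maxn n m) t| `^ p)%:E <=
    (2 ^- m * (B * h `^ p))%:E)%E.
  rewrite integral_rademacher_sum ?leq_maxr// lee_fin ler_pM2l//.
  rewrite BE; apply: sign_average_powR_le => //.
    apply: (le_trans (dyadic_value_le _ _ _)).
    by apply: (@le_trans _ _ (\sum_(k < m) `|a k|)); [exact: ler_sum|rewrite lerDl ltW].
  apply: (@le_trans _ _ (M ^+ 2)); last first.
    by apply: lerXn2r; rewrite ?nnegrE ?(ltW M0) ?(ltW hp)// lerDr.
  rewrite big_map; apply: le_trans (h2 (maxn n m)).
  rewrite -(sum_iota (fun k => a k ^+ 2)) -{2}(subnKC (leq_maxr n m)) iotaD big_cat/= add0n.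
  apply: ler_wpDl; first by apply: sumr_ge0 => k _; exact: sqr_ge0.
  apply: ler_sum => k _; rewrite -(real_normK (num_real (b k))) -(real_normK (num_real (a k))).
  by apply: lerXn2r; rewrite ?nnegrE.
have mint : measurable_fun [set: R] (fun t => `|rademacher_sum b 0 (maxn n m) t| `^ p).
  apply: (measurableT_comp (measurable_powR _)); apply: measurableT_comp.
    exact: normr_measurable.
  exact: measurable_rademacher_sum.
rewrite bE; apply: (@le_trans _ _ (w l * (4 * B * h))%:E).
  apply: morrey_term_le => //; first by rewrite !mulr_ge0.
  apply: (@le_trans _ _ (\int[mu]_(t in `[(j%:R / 2 ^+ m)%R, (j.+2%:R / 2 ^+ m)%R])
      (`|rademacher_sum b 0 (maxn n m) t| `^ p)%:E)%E).
    apply: ge0_subset_integral => //.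
    - by apply: is_interval_measurable; case: sI.
    - by apply/measurable_EFinP; exact: measurable_funS mint.
  rewrite integral_adjacent_dyadic//; apply: (le_trans (leeD (piece _) (piece _))).
  rewrite -EFinD lee_fin.
  have -> : (4 * B * h) `^ p = (4 * B) `^ p * h `^ p.
    by rewrite powRM// mulr_ge0.
  have B4 : 4 * B <= (4 * B) `^ p by apply: le1r_powR => //; lra.
  have l2 : 2 ^- m <= 2 * l.
    have -> : 2 ^- m = 2 * 2 ^- m.+1 :> R by rewrite exprS invfM mulrA mulfV ?mul1r.
    by rewrite ler_pM2l// ltW.
  have hh : 0 <= h `^ p by exact: powR_ge0.
  apply: (@le_trans _ _ (l * (4 * B * h `^ p))); last first.
    by rewrite ler_pM2l// ler_wpM2r.
  have : 2 ^- m * (B * h `^ p) <= 2 * l * (B * h `^ p).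
    by rewrite ler_wpM2r// mulr_ge0.
  lra.
rewrite lee_fin.
have wlm : w l <= w (2 ^- m) by apply: (quasi_concave_nondecreasing qw); rewrite ?(ltW l0).
have wl1 : w l <= 1.
  by rewrite -w1; apply: (quasi_concave_nondecreasing qw); rewrite ?(ltW l0).
have wh : w l * h <= 2 * M.
  rewrite /h mulrDr; have := h1 m.
  have : w l * \sum_(k < m) `|a k| <= w (2 ^- m) * \sum_(k < m) `|a k| by rewrite ler_wpM2r.
  have : w l * M <= 1 * M by rewrite ler_pM2r.
  lra.
have -> : w l * (4 * B * h) = 4 * B * (w l * h) by ring.
have -> : 8 * moment_bound p * M = 4 * B * (2 * M) by rewrite BE; ring.
by rewrite ler_wpM2l// mulr_ge0.
Qed.

End morrey_estimates.

(** * Completeness of the Morrey space *)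

Lemma cvg_powR (R : realType) (p : R) (u : nat -> R) (l : R) : 1 <= p ->
  (forall n, 0 <= u n) -> 0 <= l -> u @ \oo --> l ->
  u n `^ p @[n --> \oo] --> l `^ p.
Proof.
move=> p1 u0; have p0 : 0 < p by exact: lt_le_trans p1.
rewrite le_eqVlt => /orP[/eqP <-|l0] ul.
  rewrite powR0 ?gt_eqF//; apply/(@seq_cvgP R R^o) => e e0.
  have e10 : 0 < Num.min 1 e by rewrite lt_min ltr01.
  have [N hN] := iffLR (@seq_cvgP R R^o _ _) ul _ e10; exists N => n Nn.
  have := hN n Nn; rewrite !subr0 !ger0_norm ?powR_ge0// le_min => /andP[u1 ue].
  apply: le_trans ue; have := u0 n; rewrite le_eqVlt => /orP[/eqP <-|un0].
    by rewrite powR0// gt_eqF.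
  by apply: ge1r_powR => //; rewrite un0.
have -> : l `^ p = expR (p * ln l) by rewrite /powR gt_eqF.
have h : expR (p * ln (u n)) @[n --> \oo] --> expR (p * ln l).
  apply: (continuous_cvg _ (@continuous_expR R _)); apply: cvgMl_tmp.
  exact: (continuous_cvg _ (continuous_ln l0) ul).
apply: cvg_trans h; apply: near_eq_cvg.
have [N _ hN] := cvgr_gt l ul 0 l0; exists N => // n /= /hN /= un0.
by rewrite /powR gt_eqF.
Qed.

Lemma limn_einf_le (R : realType) (u : nat -> \bar R) (c : \bar R) :
  (forall n, (u n <= c)%E) -> (limn_einf u <= c)%E.
Proof.
move=> uc; rewrite limn_einf_lim; apply: lime_le; first exact: is_cvg_einfs.
apply: nearW => n; apply: le_trans (uc n).
by apply: ereal_inf_lbound; exists n => /=.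
Qed.

(** A Cauchy sequence converges as soon as some subsequence does. *)
Lemma seq_complete_of_quarter_powers (R : realType) (E : normedModType R) :
  (forall v : nat -> E, (forall n, `|v n.+1 - v n| <= 4 ^- n) -> exists l : E, v @ \oo --> l) ->
  seq_complete E.
Proof.
move=> H u cu.
have pos j : 0 < 4 ^- j :> R by rewrite invr_gt0 exprn_gt0.
pose N j := projT1 (cid (cu _ (pos j))).
have NP j m n : (N j <= m)%N -> (N j <= n)%N -> `|u m - u n| <= 4 ^- j.
  by rewrite /N; case: cid => M; exact.
pose k j := (\sum_(i < j.+1) N i)%N.
have Nk i j : (i <= j)%N -> (N i <= k j)%N.
  by move=> ij; rewrite /k (bigD1 (Ordinal (ij : (i < j.+1)%N)))//= leq_addr.
have [j|l ul] := H (u \o k).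
  by apply: NP; apply: Nk.
exists l; apply/seq_cvgP => e e0.
have e2 : 0 < e / 2 by rewrite divr_gt0.
have [M1 hM1] := iffLR (seq_cvgP _ _) ul _ e2.
have c : (4^-1 : R) ^+ n @[n --> \oo] --> 0.
  by apply: cvg_expr; rewrite gtr0_norm// invf_lt1// ltr1n.
have [M2 hM2] := iffLR (@seq_cvgP R R^o _ _) c _ e2.
pose J := maxn M1 M2; exists (N J) => n Jn.
have h1 := NP J n (k J) Jn (Nk _ _ (leqnn J)).
have h2 := hM1 J (leq_maxl _ _).
have h3 : 4 ^- J <= e / 2.
  have := hM2 J (leq_maxr _ _); rewrite subr0 ger0_norm ?exprn_ge0 ?invr_ge0//.
  by rewrite exprVn.
have -> : u n - l = (u n - u (k J)) + (u (k J) - l) by rewrite addrA subrK.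
by apply: (le_trans (ler_normD _ _)); move: h1 h2 h3 => /=; lra.
Qed.

Section morrey_complete.
Context (R : realType) (p : R) (w : R -> R).
Context (p1 : 1 <= p) (qw : quasi_concave w) (w1 : w 1 = 1).
Local Notation mu := (@lebesgue_measure R).
Local Notation N := (morrey_enorm p w).
Local Notation U := (`[0 : R, 1]%classic).
Local Notation M := (morrey p1 qw w1).

Let p_gt0 : 0 < p. Proof. exact: lt_le_trans p1. Qed.

(** In fact w l >= l, since w l / l >= w 1. *)
Lemma quasi_concave_gt0 (l : R) : 0 < l -> l <= 1 -> 0 < w l.
Proof.
move=> l0 l1; have := quasi_concave_nonincreasing qw l0 l1 (lexx 1).
rewrite w1 divr1 => h; have h2 : 0 < w l / l by exact: lt_le_trans h.
by rewrite pmulr_lgt0 ?invr_gt0 in h2.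
Qed.

Lemma integral_le_of_morrey (f : R -> R) (I : set R) (l C : R) : subintervals I ->
  mu I = l%:E -> 0 < l -> l <= 1 -> 0 <= C -> (N f <= C%:E)%E ->
  (\int[mu]_(t in I) (`|f t| `^ p)%:E <= (l * (C / w l) `^ p)%:E)%E.
Proof.
move=> sI lE l0 l1 C0 Nf; have wl := quasi_concave_gt0 l0 l1.
have : (morrey_term p w f I <= C%:E)%E.
  by apply: le_trans Nf; rewrite unlock; apply: ereal_sup_ubound; exists I.
rewrite /morrey_term lE/= -lee_pdivlMl//.
set J := (\int[mu]_(t in I) _)%E; have J0 : (0 <= J)%E.
  by apply: integral_ge0 => t _; rewrite lee_fin powR_ge0.
have lJ0 : (0 <= l^-1%:E * J)%E by rewrite mule_ge0// lee_fin invr_ge0 ltW.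
rewrite -EFinM => h.
have B0 : 0 <= (w l)^-1 * C by rewrite mulr_ge0// invr_ge0 ltW.
have {}h : (((l^-1%:E * J) `^ p^-1) `^ p <= ((w l)^-1 * C)%:E `^ p)%E.
  apply: gt0_ler_poweR h; rewrite ?(ltW p_gt0)// in_itv/= leey andbT//.
  exact: poweR_ge0.
rewrite -poweRrM mulVf ?gt_eqF// poweRe1// poweR_EFin in h.
rewrite [C / _]mulrC EFinM -lee_pdivrMl//.
Qed.

(** Fatou's lemma on each interval. *)
Lemma morrey_enorm_lsc (h : nat -> R -> R) (F : R -> R) (C : R) : 0 <= C ->
  (forall i, measurable_fun U (h i)) -> (forall t, U t -> h^~ t @ \oo --> F t) ->
  (forall i, (N (h i) <= C%:E)%E) -> (N F <= C%:E)%E.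
Proof.
move=> C0 mh hF hC; rewrite unlock; apply: ge_ereal_sup => _ [I sI <-].
have [l [lE l0 l1]] := subinterval_length sI.
have wl := quasi_concave_gt0 l0 l1; have [iI IU _] := sI.
have mI : measurable I by exact: is_interval_measurable.
have -> : C = w l * (C / w l) by field; rewrite gt_eqF.
apply: (morrey_term_le p1 qw sI lE) => //; first by rewrite divr_ge0// ltW.
have -> : (\int[mu]_(t in I) (`|F t| `^ p)%:E =
    \int[mu]_(t in I) limn_einf (fun i => (`|h i t| `^ p)%:E))%E.
  apply: eq_integral => t; rewrite inE => It; apply/esym.
  have c : `|h i t| `^ p @[i --> \oo] --> `|F t| `^ p.
    by apply: cvg_powR => //; apply: cvg_norm; exact/hF/IU.
  have c' : (`|h i t| `^ p)%:E @[i --> \oo] --> (`|F t| `^ p)%:E.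
    by apply: cvg_EFin c; apply: nearW.
  by have [-> _] := cvg_limn_einf_sup c'.
have mhI i : measurable_fun I (fun t => (`|h i t| `^ p)%:E).
  apply/measurable_EFinP; apply: (measurableT_comp (measurable_powR _)).
  by apply: measurableT_comp; [exact: normr_measurable|exact: measurable_funS (mh i)].
have h0 i t : I t -> (0 <= (`|h i t| `^ p)%:E)%E by rewrite lee_fin powR_ge0.
apply: (le_trans (fatou mu mI mhI h0)).
by apply: limn_einf_le => i; exact: integral_le_of_morrey.
Qed.

Local Open Scope quotient_scope.

Lemma pi_morreyB (f g : morrey_fun p1 qw w1) : \pi_M (f - g)%R = \pi_M f - \pi_M g.
Proof.
have piD (f' g' : morrey_fun p1 qw w1) : \pi_M (f' + g')%R = \pi_M f' + \pi_M g'.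
  exact: Quotient.pi_add.
by apply/eqP; rewrite eq_sym subr_eq -piD subrK.
Qed.

(** As for L^p: the representatives f n of a rapidly converging sequence satisfy
    int (2^n |f n.+1 - f n|)^p <= 2^-n, so that 2^n |f n.+1 - f n| is bounded almost
    everywhere and f n converges almost everywhere; the norm of the remainder is then
    controlled by lower semicontinuity. *)
Lemma seq_complete_morrey : seq_complete (morrey p1 qw w1).
Proof.
apply: seq_complete_of_quarter_powers => v hv.
pose f n : morrey_fun p1 qw w1 := repr (v n).
have fE n : \pi_M (f n) = v n by rewrite reprK.
have mf n : measurable_fun U (f n) by have [] := morrey_funP (f n).
have Nd n : (N (f n.+1 - f n)%R <= (4 ^- n)%:E)%E.
  by rewrite -morrey_normE pi_morreyB !fE lee_fin; exact: hv.
have subU : subintervals U.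
  split => //; first exact: interval_is_interval.
  by rewrite lebesgue_measure_itv/= lte_fin ltr01 oppr0 adde0 lte_fin.
have muU : mu U = 1%:E by rewrite lebesgue_measure_itv/= lte_fin ltr01 oppr0 adde0.
pose g n t := (2 ^+ n * `|f n.+1 t - f n t|) `^ p.
have g0 n t : 0 <= g n t by exact: powR_ge0.
have mg n : measurable_fun U (g n).
  apply: (measurableT_comp (measurable_powR _)); apply: measurable_funM.
    exact: measurable_cst.
  apply: measurableT_comp; first exact: normr_measurable.
  exact: measurable_funB.
have mG : measurable_fun U (fun t => \sum_(n <oo) (g n t)%:E)%E.
  apply: (ge0_emeasurable_sum (P := xpredT)) => [n t _ _|n _]; first by rewrite lee_fin.
  exact/measurable_EFinP.
have int_g n : (\int[mu]_(t in U) (g n t)%:E <= (2 ^- n)%:E)%E.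
  have -> : (\int[mu]_(t in U) (g n t)%:E =
      ((2 ^+ n) `^ p)%:E * \int[mu]_(t in U) (`|f n.+1 t - f n t| `^ p)%:E)%E.
    rewrite -ge0_integralZl_EFin ?powR_ge0//.
    - by apply: eq_integral => t _; rewrite -EFinM -powRM ?exprn_ge0.
    - apply/measurable_EFinP; apply: (measurableT_comp (measurable_powR _)).
      apply: measurableT_comp; first exact: normr_measurable.
      exact: (measurable_funB (mf n.+1) (mf n)).
  have q0 : 0 <= 4 ^- n :> R by rewrite invr_ge0 exprn_ge0.
  have h := integral_le_of_morrey subU muU ltr01 (lexx 1) q0 (Nd n).
  rewrite w1 divr1 mul1r in h.
  apply: (@le_trans _ _ (((2 ^+ n) `^ p)%:E * ((4 ^- n) `^ p)%:E)%E).
    by rewrite lee_wpmul2l// lee_fin powR_ge0.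
  rewrite -EFinM lee_fin -powRM ?exprn_ge0//.
  have -> : 2 ^+ n * 4 ^- n = 2 ^- n :> R.
    have -> : 4 = 2 * 2 :> R by rewrite -natrM.
    by rewrite exprMn; field; rewrite expf_neq0.
  apply: ge1r_powR => //; rewrite invr_gt0 exprn_gt0//= invf_le1 ?exprn_gt0//.
  by rewrite exprn_ege1// ler1n.
have intG : (\int[mu]_(t in U) \sum_(n <oo) (g n t)%:E < +oo)%E.
  rewrite integral_nneseries//; last 2 first.
  - by move=> n; apply/measurable_EFinP; exact: mg.
  - by move=> n t _; rewrite lee_fin.
  apply: le_lt_trans (ltry 2); apply: lime_le.
    by apply: is_cvg_nneseries => n _ _; apply: integral_ge0 => t _; rewrite lee_fin.
  apply: nearW => n; apply: (@le_trans _ _ (2 - 2 * 2 ^- n)%:E); last first.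
    by rewrite lee_fin gerBl mulr_ge0// invr_ge0 exprn_ge0.
  elim: n => [|n IH]; first by rewrite big_geq// expr0 invr1 mulr1 subrr.
  rewrite big_nat_recr//=; apply: (le_trans (leeD IH (int_g n))).
  rewrite -EFinD lee_fin exprS invfM; set q := 2 ^- n; lra.
pose Good := U `&` [set t | (\sum_(n <oo) (g n t)%:E)%E \is a fin_num].
have mGood : measurable Good by apply: emeasurable_fin_num.
have aeGood : {ae mu, forall t, U t -> Good t}.
  have ig : mu.-integrable U (fun t => \sum_(n <oo) (g n t)%:E)%E.
    apply/integrableP; split => //.
    have G0 t : (0 <= \sum_(n <oo) (g n t)%:E)%E.
      by apply: nneseries_ge0 => n _ _; rewrite lee_fin.
    by under eq_integral => t _ do rewrite (gee0_abs (G0 t)).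
  have mU : measurable (U : set (measurableTypeR R)) by exact: measurable_itv.
  have fin := integrable_ae mU ig.
  apply: (@filterS _ _ (ae_filter_ringOfSetsType mu) _ _ _ fin).
  by move=> t Gt Ut; split => //; exact: Gt.
(* representatives that converge everywhere *)
pose h n := (f n : R -> R) \_ Good.
have mh n : measurable_fun [set: R] (h n).
  apply: (iffLR (measurable_restrictT _ mGood)); apply: measurable_funS (mf n) => //.
  by move=> t [].
have h_cvg t : exists l : R, h n t @[n --> \oo] --> l.
  have [Gt|nGt] := pselect (Good t); last first.
    exists 0; apply: cvg_near_cst; apply: nearW => n.
    by rewrite /h patchE memNset.
  have [Ut fG] := Gt; pose G := fine (\sum_(n <oo) (g n t)%:E)%E.
  have gG n : g n t <= G.
    rewrite -lee_fin fineK//; apply: le_trans (nneseries_lim_ge n.+1 _) => /=.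
      by rewrite big_nat_recr//= leeDr// sume_ge0// => i _; rewrite lee_fin.
    by move=> i _ _; rewrite lee_fin.
  have hE n : h n t = f n t by rewrite /h patchE mem_set.
  apply: (@seq_complete_half_powers _ R^o _ (G `^ p^-1)); first exact: seq_complete_real.
  move=> n; rewrite !hE ler_pdivlMr ?exprn_gt0// mulrC.
  have -> : 2 ^+ n * `|f n.+1 t - f n t| = g n t `^ p^-1.
    by rewrite /g -powRrM mulfV ?gt_eqF// powRr1// mulr_ge0// exprn_ge0.
  apply: ge0_ler_powR => //; rewrite ?nnegrE ?invr_ge0 ?(ltW p_gt0)//.
  exact: le_trans (gG n).
pose F t := projT1 (cid (h_cvg t)).
have hF t : h n t @[n --> \oo] --> F t by rewrite /F; case: cid.
have mF : measurable_fun U F.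
  apply: (@measurable_fun_cvg _ _ _ U h) => [n|t _]; last exact: hF.
  exact: measurable_funS (mh n).
have hin n : h n \in morrey_fun_pred p1 qw w1.
  apply/asboolP; have mhU : measurable_fun U (h n) by exact: measurable_funS (mh n).
  split => //.
  pose fn : R -> R := f n.
  have mhf : measurable_fun U (h n - fn)%R by exact: (measurable_funB mhU (mf n)).
  have -> : h n = (fn + (h n - fn))%R by rewrite addrC subrK.
  apply: (le_lt_trans (morrey_enormD p1 qw (mf n) mhf)).
  rewrite (morrey_enorm_null p1 qw mhf) ?adde0; first by have [] := morrey_funP (f n).
  apply: (@filterS _ _ (ae_filter_ringOfSetsType mu) _ _ _ aeGood) => t Gt Ut /=.
  rewrite [LHS](_ : _ = h n t - fn t)// /h patchE mem_set ?subrr//; exact: Gt.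
pose H n := MorreyFun (hin n).
have HE n : \pi_M (H n) = v n.
  rewrite -fE; apply/eq_morreyP.
  apply: (@filterS _ _ (ae_filter_ringOfSetsType mu) _ _ _ aeGood) => t Gt Ut /=.
  by rewrite /h patchE mem_set//; exact: Gt.
have vdist m n : `|v (m + n)%N - v m| <= 2 * 2 ^- m.
  have hv' k : `|v k.+1 - v k| <= 1 / 2 ^+ k.
    apply: (le_trans (hv k)); rewrite div1r lef_pV2 ?posrE ?exprn_gt0//.
    by apply: lerXn2r; rewrite ?nnegrE// ler_nat.
  apply: (le_trans (dist_half_powers hv' m n)); rewrite mulr1 gerBl.
  by rewrite divr_ge0// exprn_ge0.
have NF m : (N (F \- h m)%R <= (2 * 2 ^- m)%:E)%E.
  apply: (@morrey_enorm_lsc (fun i => h (m + i)%N \- h m)).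
  - by rewrite mulr_ge0// invr_ge0 exprn_ge0.
  - by move=> i; apply: measurable_funS (measurable_funB (mh _) (mh m)).
  - move=> t _; apply: cvgB; last exact: cvg_cst.
    have := hF t; rewrite -(cvg_shiftn m); apply: cvg_trans; apply: near_eq_cvg.
    by apply: nearW => i; rewrite addnC.
  - move=> i; have -> : h (m + i)%N \- h m = H (m + i)%N - H m by [].
    by rewrite -morrey_normE pi_morreyB !HE lee_fin; exact: vdist.
have Fin : F \in morrey_fun_pred p1 qw w1.
  apply/asboolP; split => //.
  have mh0 : measurable_fun U (h 0%N) by exact: measurable_funS (mh _).
  have mFh : measurable_fun U (F \- h 0%N)%R by exact: (measurable_funB mF mh0).
  have -> : F = (h 0%N + (F \- h 0%N))%R.
    by apply/funext => t; rewrite [RHS](_ : _ = h 0%N t + (F t - h 0%N t))// addrC subrK.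
  apply: (le_lt_trans (morrey_enormD p1 qw mh0 mFh)); apply: lte_add_pinfty.
    by have [] := morrey_funP (H 0%N).
  exact: le_lt_trans (NF 0%N) (ltry _).
exists (\pi_M (MorreyFun Fin)); apply/seq_cvgP => e e0.
have [K hK] := half_powers_small 2 e0; exists K => n Kn.
apply: le_trans (hK n Kn).
rewrite distrC -HE -pi_morreyB -[X in X <= _]/(morrey_norm _) -lee_fin morrey_normE.
exact: NF.
Qed.

End morrey_complete.

(** * The Rademacher system in the Morrey space *)

Section morrey_rademacher_system.
Context (R : realType) (p : R) (w : R -> R).
Context (p1 : 1 <= p) (qw : quasi_concave w) (w1 : w 1 = 1).
Local Notation M := (morrey p1 qw w1).

Let e (k : nat) : M := morrey_rademacher p1 qw w1 k.+1.

Local Open Scope quotient_scope.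

Lemma norm_psum_rademacher n (a : nat -> R) :
  (`|psum e n a|%:E = morrey_enorm p w (rademacher_sum a 0 n))%E.
Proof.
pose f k : morrey_fun p1 qw w1 := MorreyFun (rademacher_in p1 qw w1 k.+1).
have piD (g h : morrey_fun p1 qw w1) : \pi_M (g + h)%R = \pi_M g + \pi_M h.
  exact: Quotient.pi_add.
have piZ c (g : morrey_fun p1 qw w1) : \pi_M (c *: g)%R = c *: \pi_M g.
  rewrite -[RHS]/(morrey_scale c (\pi_M g)).
  unlock morrey_scale; apply/eqP; rewrite -Quotient.idealrBE -scalerBr; apply: rpredZ.
  by rewrite Quotient.idealrBE reprK.
have [F FE Fpi] : exists2 F : morrey_fun p1 qw w1,
    (F : R -> R) = rademacher_sum a 0 n & \pi_M F = psum e n a.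
  rewrite /rademacher_sum /psum -(big_mkord xpredT (fun k => a k *: e k)) /index_iota subn0.
  elim: (iota 0 n) => [|k s [F FE Fpi]].
    exists 0; first by apply/funext => t; rewrite big_nil.
    rewrite big_nil; apply: (addrI (\pi_M (0 : morrey_fun p1 qw w1))).
    by rewrite -piD !addr0.
  exists (a k *: f k + F); last by rewrite piD piZ Fpi big_cons.
  apply/funext => t; rewrite big_cons.
  by rewrite -[LHS]/(a k * rademacher k.+1 t + F t) FE.
by rewrite -Fpi -[X in X%:E]/(morrey_norm _) morrey_normE FE.
Qed.

Let K := 8 * moment_bound p.

Let K_ge8 : 8 <= K.
Proof. by have := moment_bound_ge1 p1; rewrite /K; lra. Qed.

Lemma psum_rademacher_ge_l2 n (a : nat -> R) :
  \sum_(k < n) a k ^+ 2 <= (K * `|psum e n a|) ^+ 2.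
Proof.
have s0 : 0 <= \sum_(k < n) a k ^+ 2 by apply: sumr_ge0 => k _; exact: sqr_ge0.
have := morrey_enorm_ge_l2 p1 qw w1 a n; rewrite -norm_psum_rademacher lee_fin.
rewrite ler_pdivrMr// -{2}(sqr_sqrtr s0) => h.
apply: lerXn2r; rewrite ?nnegrE ?sqrtr_ge0//.
  by rewrite mulr_ge0// (le_trans _ K_ge8).
by apply: (le_trans h); rewrite mulrC ler_wpM2r// (le_trans _ K_ge8)// ler_nat.
Qed.

Lemma psum_rademacher_ge_l1 m n (a : nat -> R) : (m <= n)%N ->
  w (2 ^- m) * \sum_(k < m) `|a k| <= K * `|psum e n a|.
Proof.
move=> mn; have := morrey_enorm_ge_l1 p1 qw a mn.
rewrite -norm_psum_rademacher lee_fin => /le_trans; apply.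
by rewrite ler_peMl// (le_trans _ K_ge8)// ler1n.
Qed.

Lemma psum_rademacher_le c (a : nat -> R) : 0 < c ->
  (forall n, \sum_(k < n) a k ^+ 2 <= c ^+ 2) ->
  (forall m, w (2 ^- m) * \sum_(k < m) `|a k| <= c) ->
  forall n, `|psum e n a| <= K * c.
Proof.
move=> c0 h2 h1 n; rewrite -lee_fin norm_psum_rademacher.
exact: morrey_enorm_le.
Qed.

Lemma rademacher_spanE : rademacher_span p1 qw w1 = closed_span (range e).
Proof.
rewrite /rademacher_span; congr closed_span.
apply/seteqP; split=> _ [k /= k0 <-]; last by exists k.+1.
by exists k.-1 => //; rewrite /e prednK.
Qed.

End morrey_rademacher_system.

Theorem theorem4 (R : realType) (p : R) (w : R -> R)
    (p1 : 1 <= p) (qw : quasi_concave w) (w1 : w 1 = 1)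
    (w0 : w t @[t --> 0^'+] --> (0 : R))
    (X : set (morrey p1 qw w1)) :
  X `<=` rademacher_span p1 qw w1 ->
  linear_subspace X -> closed X -> ~ finite_dimensional X ->
  isomorphic X (l2 R) \/
  exists Y : set (morrey p1 qw w1),
    [/\ Y `<=` X, linear_subspace Y, closed Y, isomorphic Y (c0 R)
      & complemented_in Y (rademacher_span p1 qw w1)].
Proof.
rewrite rademacher_spanE; pose W m := w (2 ^- m).
have W0 m : 0 <= W m.
  apply: (quasi_concave_ge0 qw); rewrite invr_ge0 exprn_ge0//=.
  by rewrite invf_le1 ?exprn_gt0// exprn_ege1// ler1n.
have Wcvg : W @ \oo --> (0 : R).
  apply/(@seq_cvgP R R^o) => eps eps0.
  have /cvgrPdist_le/(_ _ eps0) [d /= d0 hd] := w0.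
  have [N hN] := half_powers_small 2 d0; exists N => n Nn.
  have p0 : 0 < 2 ^- n :> R by rewrite invr_gt0 exprn_gt0.
  rewrite distrC; apply: hd => //=; rewrite sub0r normrN gtr0_norm//.
  by have := hN n Nn; lra.
have K1 : 1 <= 8 * moment_bound p by have := moment_bound_ge1 p1; lra.
exact: (l2_or_complemented_c0 (@seq_complete_morrey R p w p1 qw w1) W0 Wcvg K1
  (psum_rademacher_ge_l2 p1 qw w1) (psum_rademacher_ge_l1 p1 qw w1)
  (psum_rademacher_le p1 qw w1)).
Qed.
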